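(* Let $a<b<\infty$, $\sigma\in\mathbb{R}$, $\rho\neq 0$ and $\alpha,\beta>0$. If $\psi\in\Lambda^1_{\sigma,\rho}[a,b]$, then $$ {}_\sigma I_a^{\alpha,\rho}\,{}_\sigma I_a^{\beta,\rho}\psi(t)={}_\sigma I_a^{\alpha+\beta,\rho}\psi(t). $$
   Context: Function space: $\Lambda_{\sigma,\rho}^{1}[a,b]=\{\psi: e^{\sigma t^{\rho}}t^{1-\rho}\psi(t)\in L_1[a,b]\}$. Generalized substantial integral: for $\gamma>0$, ${}_\sigma I_a^{\gamma,\rho}\psi(t)=\frac{\rho}{\Gamma(\gamma)}\int_a^t (t^\rho-s^\rho)^{\gamma-1}e^{-\sigma(t^\rho-s^\rho)}s^{\rho-1}\psi(s)\,ds$.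
   Formalization: Assumes t^ρ is a defined real number on [a,b] (t>0; or t=0 and ρ>0; or t<0 and ρ an integer), since otherwise the formulas are undefined (e.g. a=-1, ρ=1/2); powers of negative t^ρ-s^ρ are principal complex values, and the identity is for almost every t. *)

(* Defs.v *)
From HB Require Import structures.
From mathcomp Require Export all_boot all_order all_algebra.
From mathcomp Require Export all_classical all_reals all_analysis.
From mathcomp Require Export complex.

Set Implicit Arguments.
Unset Strict Implicit.
Unset Printing Implicit Defensive.
Import Order.TTheory GRing.Theory Num.Theory.
Import numFieldNormedType.Exports.

Local Open Scope classical_set_scope.
Local Open Scope ring_scope.
Local Open Scope complex_scope.

(* The real number x ^ p makes sense for every x > 0, for x = 0 if p > 0, and
   for x < 0 if p is an integer. *)
Definition rpow_defined (R : realType) (x p : R) : Prop :=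
  0 < x \/ (x = 0 /\ 0 < p) \/ (x < 0 /\ p \is a Num.int).

(* The library's `^ is not the usual power on negative bases, hence the second
   branch, which is only meaningful when p is an integer (then p equals its
   floor and the power is the integer power). *)
Definition rpow (R : realType) (x p : R) : R :=
  if 0 <= x then x `^ p else x ^ Num.floor p.

(* Principal value of the complex power of a real base: a negative x is
   |x| e^(i pi), so that x ^ p = |x| ^ p e^(i p pi).  It is needed because
   t ^ rho - s ^ rho may be negative for s < t, e.g. when rho < 0 < s. *)
Definition cpow (R : realType) (x p : R) : R[i] :=
  (`|x| `^ p)%:C * (if 0 <= x then 1 else cos (p * pi) +i* sin (p * pi)).

Definition Gamma (R : realType) (x : R) : R :=
  Rintegral (@lebesgue_measure R) `]0, +oo[ (fun u => u `^ (x - 1) * expR (- u)).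

(* Lebesgue integrability and Lebesgue integral of complex-valued functions. *)
Definition cintegrable (R : realType) (D : set R) (f : R -> R[i]) : Prop :=
  (@lebesgue_measure R).-integrable D (fun s => (complex.Re (f s))%:E) /\
  (@lebesgue_measure R).-integrable D (fun s => (complex.Im (f s))%:E).

Definition cintegral (R : realType) (D : set R) (f : R -> R[i]) : R[i] :=
  Rintegral (@lebesgue_measure R) D (fun s => complex.Re (f s)) +i*
  Rintegral (@lebesgue_measure R) D (fun s => complex.Im (f s)).

Definition Lambda1 (R : realType) (sigma rho a b : R) : set (R -> R[i]) :=
  [set psi | cintegrable `[a, b]
     (fun t => (expR (sigma * rpow t rho) * rpow t (1 - rho))%:C * psi t)].

Definition subst_integral (R : realType) (sigma rho a gamma : R)
    (psi : R -> R[i]) (t : R) : R[i] :=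
  (rho / Gamma gamma)%:C *
  cintegral `[a, t] (fun s =>
    cpow (rpow t rho - rpow s rho) (gamma - 1)
    * (expR (- sigma * (rpow t rho - rpow s rho)))%:C
    * (rpow s (rho - 1))%:C * psi s).

(* Main.v *)
From HB Require Import structures.
Require Import Defs.
From mathcomp Require Import measurable_realfun ring lra.
Import Order.TTheory GRing.Theory Num.Theory.
Import numFieldNormedType.Exports.

(** Put [G t = t^rho], let [D t = t^(rho - 1)], so that [rho D] is the derivative
    of [G], and let [w t = exp (sigma G t) D t psi t]. The exponential in the
    kernel splits, and up to the factor [exp (- sigma G t)] and constants the
    operator of order [g] is the fractional integral of [w],
    [fint g t = int_a^t (G t - G s)^(g-1) w s ds]. The composition is an iterated
    integral of [(G t - G x)^(alpha-1) rho D x (G x - G s)^(beta-1) w s]; by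
    Fubini, the integral over [x] comes first, and it is
    [int (G t - u)^(alpha-1) (u - G s)^(beta-1) du] from [u = G s] to [u = G t],
    that is the Beta function at [(alpha, beta)] times
    [(G t - G s)^(alpha+beta-1)] ([swapped_fintE]).

    Since [t^rho - s^rho] may be negative and [G] need not be monotone (for
    instance [rho = 2] and [a < 0 < b]), these integrals are oriented and complex.
    The integrand in [x] depends on [x] through [G x] alone, up to the factor
    [rho D x], so the part of the path where [G] goes back and forth cancels: the
    substitution holds on each half-line with an orientation [chi], and Chasles'
    relation glues the halves ([oriented_substitution]). When [G t < G s], the
    reversal of the path contributes [-1 = exp (i pi)], which is the difference
    between the phase of [(G t - G s)^(alpha+beta-1)] and the product of the
    phases of the two kernels ([oriented_beta]).

    Fubini needs absolute integrability for almost every [t]. Weighted by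
    [|rho D|], the kernel [|G t - G s|^(g-1)] defines a bounded operator on
    integrable functions ([pker_bound], [pker_op_lt_pinfty]); applied twice it
    gives a function that is finite almost everywhere ([ae_pker_lt_pinfty]).

    The hypothesis is about the weight [t^(1-rho)], the operators involve
    [t^(rho-1)]. Their quotient is bounded on the interval
    ([Lambda1_integrable]), with one exception: [a = 0] and [0 < rho < 1]. There
    the kernel is real and positive, so real and imaginary parts separate. Each
    of them either is integrable for the weight [t^(rho-1)], or has only
    divergent integrals, to which both sides assign the value zero
    ([rint_semigroup]).

    The substitution rules come from the exponential and affine ones
    ([ge0_integral_powR]), and the same rules with Tonelli's theorem give
    Euler's relation between Beta and Gamma ([eBetaE]). *)

Local Open Scope classical_set_scope.
Local Open Scope ring_scope.
Set Implicit Arguments.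
Unset Strict Implicit.

(** * Images of densities *)

Section density.
Local Open Scope ereal_scope.
Context (R : realType) (g h : R -> R).
Hypotheses (mg : measurable_fun setT g) (mh : measurable_fun setT h).
Hypothesis h0 : forall x, (0 <= h x)%R.
Notation mu := (@lebesgue_measure R).

(** The image under [g] of the measure of density [h]. *)
Definition image_density (E : set (measurableTypeR R)) : \bar R :=
  \int[mu]_(x in g @^-1` E) (h x)%:E.

Let mgE (E : set R) : measurable E -> measurable (g @^-1` E).
Proof. by move=> mE; rewrite -[X in measurable X]setTI; exact: mg. Qed.

Let density0 : image_density set0 = 0.
Proof. by rewrite /image_density preimage_set0 integral_set0. Qed.

Let density_ge0 E : 0 <= image_density E.
Proof. by apply: integral_ge0 => x _; rewrite lee_fin. Qed.

Let density_additive : semi_sigma_additive image_density.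
Proof.
move=> F mF tF mUF; rewrite /image_density preimage_bigcup; apply: cvg_toP.
  apply: ereal_nondecreasing_is_cvgn => m n mn.
  by apply: lee_sum_nneg_natr => // k _ _; exact: density_ge0.
rewrite ge0_integral_bigcup//=.
- by move=> k; apply: mgE; exact: mF.
- by apply/measurable_EFinP; exact: measurable_funTS.
- by move=> x _; rewrite lee_fin.
- apply/trivIsetP => i j _ _ ij.
  by rewrite -preimage_setI; move/trivIsetP : tF => ->//; rewrite preimage_set0.
Qed.

HB.instance Definition _ := isMeasure.Build _ _ _ image_density
  density0 density_ge0 density_additive.

Import HBNNSimple.

(** An identity between measures extends from indicators to nonnegative functions
    by increasing limits of simple functions. *)
Lemma ge0_integral_image_density (I : set R) : measurable I ->
  (forall E, measurable E -> image_density E = mu (E `&` I)) ->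
  forall F : R -> \bar R, measurable_fun setT F -> (forall x, 0 <= F x) ->
  \int[mu]_x (F (g x) * (h x)%:E) = \int[mu]_(x in I) F x.
Proof.
move=> mI gI F mF F0.
pose f_ := nnsfun_approx measurableT mF.
have cf u : (f_ n u)%:E @[n --> \oo] --> F u.
  exact: cvg_nnsfun_approx.
have ndf u : {homo (fun n => f_ n u) : m n / (m <= n)%N >-> (m <= n)%R}.
  by move=> m n mn; exact/lefP/nd_nnsfun_approx.
have mhE : measurable_fun setT (EFin \o h) by exact/measurable_EFinP.
have mf n : measurable_fun setT (f_ n) by exact: measurable_funP.
have mfg n : measurable_fun setT (fun x => (f_ n (g x))%:E).
  by apply/measurable_EFinP; apply: measurableT_comp.
transitivity (limn (fun n => \int[mu]_x ((f_ n (g x))%:E * (h x)%:E))).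
  rewrite -monotone_convergence//; last 3 first.
  - by move=> n; apply: emeasurable_funM; [exact: mfg|exact: mhE].
  - by move=> n x _; rewrite mule_ge0// lee_fin.
  - by move=> x _ m n mn; rewrite -!EFinM lee_fin ler_wpM2r// ndf.
  apply: eq_integral => x _; apply/esym/cvg_lim => //.
  by under eq_fun do rewrite muleC; rewrite muleC; apply: cvgeZl.
transitivity (limn (fun n => \int[mu]_(x in I) (f_ n x)%:E)); last first.
  rewrite -monotone_convergence//; last 3 first.
  - by move=> n; apply/measurable_EFinP; apply: measurable_funTS; exact: mf.
  - by move=> n x _; rewrite lee_fin.
  - by move=> x _ m n mn; rewrite lee_fin ndf.
  by apply: eq_integral => x _; apply/cvg_lim.
congr (limn _); apply/funext => n.
have mr r : measurable (f_ n @^-1` [set r]) by [].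
have mi r : measurable_fun setT (\1_(f_ n @^-1` [set r]) : R -> R).
  exact: measurable_indic.
transitivity (\sum_(k \in range (f_ n))
    \int[mu]_x (k * \1_(f_ n @^-1` [set k]) (g x) * h x)%:E).
  under eq_integral => x _.
    rewrite fimfunE -fsumEFin// ge0_mule_fsuml; last first.
      by move=> r; exact: nnfun_muleindic_ge0.
    over.
  rewrite ge0_integral_fsum//.
  - move=> y; apply/measurable_EFinP; apply: measurable_funM => //.
    by apply: measurable_funM => //; apply: measurableT_comp.
  - by move=> y x _; rewrite !EFinM mule_ge0 ?nnfun_muleindic_ge0 ?lee_fin.
under [RHS]eq_integral do rewrite fimfunE -fsumEFin//.
rewrite [RHS]ge0_integral_fsum//; last 2 first.
- move=> y; apply/measurable_EFinP; apply: measurable_funM => //.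
  by apply: measurable_funTS; exact: mi.
- by move=> y x _; rewrite nnfun_muleindic_ge0.
apply: eq_fsbigr => r _.
have [rneg|r0] := ltP r 0%R.
  by rewrite !integral0_eq// => x _;
    rewrite (preimage_nnfun0 _ rneg) indic0/= ?mulr0 ?mul0r.
under [LHS]eq_integral do rewrite -mulrA EFinM.
rewrite ge0_integralZl//=; last 2 first.
- apply/measurable_EFinP; apply: measurable_funM => //.
  by apply: measurableT_comp; first exact: mi.
- by move=> x _; rewrite lee_fin mulr_ge0.
under [RHS]eq_integral do rewrite EFinM.
rewrite [RHS]ge0_integralZl//=; last first.
  by apply/measurable_EFinP; apply: measurable_funTS; exact: mi.
congr (_ * _); rewrite integral_indic; [|by []|exact: mr].
transitivity (image_density (f_ n @^-1` [set r])); last exact: (gI _ (mr r)).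
rewrite /image_density [RHS]integral_mkcond; apply: eq_integral => x _.
rewrite patchE indicE.
have -> : (x \in g @^-1` (f_ n @^-1` [set r])) = (g x \in f_ n @^-1` [set r]) by [].
by case: ifPn => _; rewrite ?(mul1r, mul0r).
Qed.

(** Intervals determine a measure, so a density is an image of Lebesgue measure
    as soon as it has the right mass on half-open intervals. *)
Lemma ge0_integral_substitution (I : set R) : measurable I ->
  (forall x, I (g x)) ->
  (forall p q : R, (p < q)%R ->
     \int[mu]_(x in g @^-1` `]p, q]) (h x)%:E = mu (`]p, q] `&` I)) ->
  forall F : R -> \bar R, measurable_fun setT F -> (forall x, 0 <= F x) ->
  \int[mu]_x (F (g x) * (h x)%:E) = \int[mu]_(x in I) F x.
Proof.
move=> mI gI gpq; apply: ge0_integral_image_density => // E mE.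
have mIC : measurable (~` I) by exact: measurableC.
(* Off [I] the image measure has no mass: adding Lebesgue measure there gives a
   measure to compare with Lebesgue measure on the whole line. *)
pose nu := measure_add image_density (mrestr mu mIC).
have H (A : set R) : measurable A -> mu A = image_density A + mu (A `&` ~` I).
  move=> mA; transitivity (nu A); last first.
    exact: (measure_addE image_density (mrestr mu mIC) A).
  apply: (@lebesgue_measure_unique _ nu) => // _ [[p q]] _ <-; rewrite [RHS]measure_addE/=.
  have [qp|pq] := leP q p.
    by rewrite set_itv_ge ?bnd_simp -?leNgt// !measure0 adde0.
  rewrite /image_density gpq// /mrestr -measureU//.
  - by rewrite -setIUr setUv setIT.
  - exact: measurableI.
  - exact: measurableI.
  - by rewrite setIACA setICr setI0.
have := H _ (measurableI _ _ mE mI).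
rewrite -setIA setICr setI0 measure0 adde0 => ->.
by congr (\int[mu]_(x in _) _); apply/seteqP; split => x //= [].
Qed.
End density.

(** * Affine, exponential and power substitutions *)

Section substitutions.
Local Open Scope ereal_scope.
Context (R : realType).
Notation mu := (@lebesgue_measure R).
Implicit Types F : R -> \bar R.

Lemma ge0_integral_affine (c d : R) F : (c != 0)%R ->
  measurable_fun setT F -> (forall x, 0 <= F x) ->
  \int[mu]_x (F (c * x + d)%R * `|c|%:E) = \int[mu]_x F x.
Proof.
move=> c0 mF F0.
rewrite (@ge0_integral_substitution _ (fun x => c * x + d)%R (fun=> `|c|%R) _ _ _ setT)//.
- by apply: measurable_funD => //; apply: measurable_funM.
- move=> p q pq; rewrite setIT integral_cst//=; last first.
    rewrite -[X in measurable X]setTI.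
    suff : measurable_fun setT (fun x : R => c * x + d)%R by apply.
    by apply: measurable_funD => //; apply: measurable_funM.
  have [cgt|clt|/eqP] := ltgtP 0%R c; last by rewrite eq_sym (negbTE c0).
  + have -> : (fun x => c * x + d)%R @^-1` `]p, q] = `]((p - d) / c)%R, ((q - d) / c)%R]%classic.
      apply/seteqP; split => x /=; rewrite !in_itv/= ltr_pdivrMr// ler_pdivlMr// => /andP[? ?];
        apply/andP; split; lra.
    rewrite !lebesgue_measure_itv/= !lte_fin pq ltr_pM2r ?invr_gt0// ltrD2r pq.
    rewrite -!EFinD -EFinM gtr0_norm//; congr EFin; field.
    by rewrite gt_eqF.
  + have -> : (fun x => c * x + d)%R @^-1` `]p, q] = `[((q - d) / c)%R, ((p - d) / c)%R[%classic.
      apply/seteqP; split => x /=; rewrite !in_itv/= ltr_ndivlMr// ler_ndivrMr// => /andP[? ?];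
        apply/andP; split; lra.
    rewrite !lebesgue_measure_itv/= !lte_fin pq ltr_nM2r ?invr_lt0// ltrD2r pq.
    rewrite -!EFinD -EFinM ltr0_norm//; congr EFin; field.
    by rewrite lt_eqF.
Qed.

Lemma integral_expR_Nyc (y : R) :
  \int[mu]_(x in `]-oo, y]) (expR x)%:E = (expR y)%:E.
Proof.
(* The reflection at [y] turns the integrand into [exp y] times the exponential
   density, whose total mass is one. *)
rewrite integral_mkcond -(@ge0_integral_affine (-1) y)//=; last 2 first.
- apply/(measurable_restrictT _ _).1 => //.
  by apply/measurable_EFinP; apply: measurable_funTS; exact: measurable_expR.
- by move=> x; rewrite patchE; case: ifPn => // _; rewrite lee_fin expR_ge0.
transitivity (\int[mu]_x ((expR y)%:E * (exponential_pdf 1 x)%:E)).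
  apply: eq_integral => x _; rewrite normrN1 mule1 patchE /exponential_pdf patchE.
  have -> : ((-1 * x + y)%R \in `]-oo, y]%classic) = (x \in `[0%R, +oo[%classic).
    by apply/idP/idP; rewrite !inE/= !in_itv/= ?andbT; lra.
  case: ifPn => _; last by rewrite mule0.
  by rewrite -EFinM mul1r expRD mulrC.
rewrite ge0_integralZl//=.
- by rewrite integral_exponential_pdf// mule1.
- by apply/measurable_EFinP; exact: measurable_exponential_pdf.
- by move=> x _; rewrite lee_fin exponential_pdf_ge0.
Qed.

Lemma ge0_integral_expR F : measurable_fun setT F -> (forall x, 0 <= F x) ->
  \int[mu]_x (F (expR x) * (expR x)%:E) = \int[mu]_(x in `]0%R, +oo[) F x.
Proof.
move=> mF F0.
apply: (@ge0_integral_substitution R expR expR (@measurable_expR R)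
  (@measurable_expR R) (@expR_ge0 R) `]0%R, +oo[%classic) => //.
- by move=> x /=; rewrite in_itv/= andbT expR_gt0.
move=> p q pq; have [q0|q0] := leP q 0%R.
  rewrite (_ : _ @^-1` _ = set0) ?integral_set0; last first.
    rewrite -subset0 => x /=; rewrite in_itv/= => /andP[_].
    by move/le_trans => /(_ _ q0); rewrite leNgt expR_gt0.
  rewrite (_ : _ `&` _ = set0) ?measure0// -subset0 => x /=.
  by rewrite !in_itv/= => -[]; lra.
have [p0|p0] := leP p 0%R.
  rewrite (_ : _ @^-1` _ = `]-oo, ln q]%classic); last first.
    apply/seteqP; split => x /=; rewrite !in_itv/=.
      by case/andP => _; rewrite -{1}(lnK q0) ler_expR.
    by move=> xq; rewrite (le_lt_trans p0 (expR_gt0 _))/= -(lnK q0) ler_expR.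
  rewrite integral_expR_Nyc lnK//.
  rewrite (_ : _ `&` _ = `]0%R, q]%classic); last first.
    by apply/seteqP; split => x /=; rewrite !in_itv/=; lra.
  by rewrite lebesgue_measure_itv/= lte_fin q0 oppr0 adde0.
rewrite (_ : _ @^-1` _ = `]ln p, ln q]%classic); last first.
  have E x : (p < expR x <= q)%R = (ln p < x <= ln q)%R.
    by rewrite -{1}(lnK p0) -{1}(lnK q0) ltr_expR ler_expR.
  by apply/seteqP; split => x /=; rewrite !in_itv/= E.
rewrite (_ : _ `&` _ = `]p, q]%classic); last first.
  by apply/seteqP; split => x /=; rewrite !in_itv/=; lra.
have lnpq : (ln p < ln q)%R by rewrite ltr_ln.
have me (D : set R) : measurable D -> measurable_fun D (EFin \o @expR R).
  by move=> mD; apply/measurable_EFinP; apply: measurable_funTS; exact: measurable_expR.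
have := integral_expR_Nyc (ln q).
rewrite (_ : `]-oo, ln q]%classic = `]-oo, ln p]%classic `|` `]ln p, ln q]%classic); last first.
  apply/seteqP; split => x /=; rewrite !in_itv/=; last lra.
  by move=> xq; have [?|?] := leP x (ln p); [left|right].
rewrite ge0_integral_setU//=; last 2 first.
- exact: (me _ (measurableU _ _ (measurable_itv _) (measurable_itv _))).
- apply/disj_setPS => x /=; rewrite !in_itv/= => -[]; lra.
rewrite integral_expR_Nyc !lnK// lebesgue_measure_itv/= lte_fin pq.
by move=> /(congr1 (fun z => z - p%:E)); rewrite addeAC subee// add0e.
Qed.

(** In logarithmic coordinates a power is a dilation, so this substitution is the
    exponential one conjugating the affine one. This covers Jacobians that are
    singular at the origin. *)
Lemma ge0_integral_powR (rho : R) F : (rho != 0)%R ->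
  measurable_fun setT F -> (forall x, 0 <= F x) ->
  \int[mu]_(x in `]0%R, +oo[)
    (F (x `^ rho)%R * (`|rho| * x `^ (rho - 1))%R%:E)
  = \int[mu]_(x in `]0%R, +oo[) F x.
Proof.
move=> rho0 mF F0.
rewrite -(@ge0_integral_expR (fun x : R => F (x `^ rho)%R * (`|rho| * x `^ (rho - 1))%R%:E)); last 2 first.
- apply: emeasurable_funM.
    by apply: measurableT_comp => //; exact: measurable_powR.
  apply/measurable_EFinP; apply: measurable_funM => //; exact: measurable_powR.
- by move=> x; rewrite mule_ge0// lee_fin mulr_ge0// powR_ge0.
rewrite -ge0_integral_expR//.
rewrite -(@ge0_integral_affine rho 0 (fun x => F (expR x) * (expR x)%:E))//; last 2 first.
- apply: emeasurable_funM; last by apply/measurable_EFinP; exact: measurable_expR.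
  by apply: measurableT_comp => //; exact: measurable_expR.
- by move=> x; rewrite mule_ge0// lee_fin expR_ge0.
apply: eq_integral => x _; rewrite addr0.
have ea a : (expR x `^ a = expR (a * x))%R by rewrite -expRM mulrC.
rewrite !ea.
rewrite -!muleA -!EFinM; congr (_ * _%:E).
by rewrite -mulrA -expRD [RHS]mulrC; congr (_ * expR _)%R; ring.
Qed.

End substitutions.

(** * The Gamma and Beta integrals *)

Section gamma_beta.
Context (R : realType).
Notation mu := (@lebesgue_measure R).

(** The one-sided power kernel: the convolution of two of them is again one, up
    to the factor [eBeta]. *)
Definition ppow (g x : R) : R := if 0 < x then x `^ (g - 1) else 0.

Lemma ppow_ge0 g x : 0 <= ppow g x.
Proof. by rewrite /ppow; case: ifPn => // _; exact: powR_ge0. Qed.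

Lemma measurable_ppow g : measurable_fun setT (ppow g).
Proof.
apply: measurable_fun_ifT; [|exact: measurable_powR|by []].
by apply: measurable_fun_ltr.
Qed.

Lemma ppowM g w x : 0 < w -> ppow g (w * x) = w `^ (g - 1) * ppow g x.
Proof.
move=> w0; rewrite /ppow pmulr_rgt0//; case: ifPn => x0; last by rewrite mulr0.
by rewrite powRM// ltW.
Qed.

Local Open Scope ereal_scope.

Definition eGamma (g : R) : \bar R := \int[mu]_x (ppow g x * expR (- x))%:E.

Definition eBeta (a b : R) : \bar R := \int[mu]_u (ppow a (1 - u) * ppow b u)%:E.

Lemma measurable_ppow_conv (a b T S : R) :
  measurable_fun setT (fun u : R => (ppow a (T - u) * ppow b (u - S))%:E).
Proof.
apply/measurable_EFinP; apply: measurable_funM.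
  apply: measurableT_comp; first exact: measurable_ppow.
  exact: measurable_funB.
apply: measurableT_comp; first exact: measurable_ppow.
exact: measurable_funB.
Qed.

Lemma eBeta_ge0 a b : 0 <= eBeta a b.
Proof. by apply: integral_ge0 => x _; rewrite lee_fin mulr_ge0// ppow_ge0. Qed.

(** The affine map from [0, 1] to [S, T] reduces every case to [eBeta], by
    homogeneity of the kernels. *)
Lemma integral_ppow_conv (a b T S : R) :
  \int[mu]_u (ppow a (T - u) * ppow b (u - S))%:E
  = eBeta a b * (ppow (a + b) (T - S))%:E.
Proof.
have p0 a' b' (x y : R) : 0 <= (ppow a' x * ppow b' y)%:E.
  by rewrite lee_fin mulr_ge0// ppow_ge0.
have [TS|ST] := leP T S.
  rewrite integral0_eq => [|u _]; last first.
    rewrite /ppow; case: ltP => uT; case: ltP => uS; rewrite ?mulr0 ?mul0r//.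
    by exfalso; lra.
  by rewrite {1}/ppow ltNge subr_le0 TS/= mule0.
have w0 : (0 < T - S)%R by rewrite subr_gt0.
have K (u : R) : (ppow a (T - ((T - S) * u + S)) * ppow b ((T - S) * u + S - S)
    * `|T - S| = ppow (a + b) (T - S) * (ppow a (1 - u) * ppow b u))%R.
  rewrite (_ : T - _ = (T - S) * (1 - u))%R; last by ring.
  rewrite addrK !ppowM// gtr0_norm// {3}/ppow w0.
  have e : ((T - S) `^ (a + b - 1)
      = (T - S) `^ (a - 1) * (T - S) `^ (b - 1) * (T - S))%R.
    rewrite -{4}[(T - S)%R]powRr1 ?ltW//.
    rewrite -!powRD; [congr (_ `^ _)%R; ring | |];
      by apply/implyP => _; rewrite gt_eqF.
  by rewrite e; ring.
rewrite -(@ge0_integral_affine _ (T - S)%R S)//=; last 2 first.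
- by rewrite gt_eqF.
- exact: measurable_ppow_conv.
have mB : measurable_fun setT (fun u : R => (ppow a (1 - u) * ppow b u)%:E).
  have := measurable_ppow_conv a b 1%R 0%R.
  by under eq_fun do rewrite subr0.
rewrite /eBeta muleC -ge0_integralZl//=; last first.
  by rewrite lee_fin ppow_ge0.
apply: eq_integral => u _; rewrite -!EFinM; congr EFin; exact: K.
Qed.

Lemma ge0_integral_translate (F : R -> \bar R) d :
  measurable_fun setT F -> (forall x, 0 <= F x) ->
  \int[mu]_x F (x + d)%R = \int[mu]_x F x.
Proof.
move=> mF F0; rewrite -(@ge0_integral_affine _ 1 d F)//.
by apply: eq_integral => x _; rewrite mul1r normr1 mule1.
Qed.

(** Tonelli on the positive quadrant with the total [w = x + y] as variable: for
    a fixed total, the inner integral is a convolution of power kernels. *)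
Lemma eGammaM a b : eGamma a * eGamma b = eBeta a b * eGamma (a + b).
Proof.
pose f (w y : R) := (ppow a (w - y) * ppow b y * expR (- w))%:E.
have mf2 : measurable_fun setT (fun z : R * R => f z.1 z.2).
  apply/measurable_EFinP; apply: measurable_funM; first apply: measurable_funM.
  - by apply: measurableT_comp; [exact: measurable_ppow|exact: measurable_funB].
  - by apply: measurableT_comp; [exact: measurable_ppow|exact: measurable_snd].
  - apply: measurableT_comp; first exact: measurable_expR.
    by apply: measurable_funN; exact: measurable_fst.
have f0 w y : 0 <= f w y.
  by rewrite lee_fin !mulr_ge0// ?ppow_ge0// expR_ge0.
have mg g : measurable_fun setT (fun x : R => (ppow g x * expR (- x))%:E).
  apply/measurable_EFinP; apply: measurable_funM; first exact: measurable_ppow.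
  apply: measurableT_comp; first exact: measurable_expR.
  exact: measurable_funN.
have g0 g (x : R) : 0 <= (ppow g x * expR (- x))%:E.
  by rewrite lee_fin mulr_ge0// ?ppow_ge0// expR_ge0.
have fE (w y : R) :
    f w y = (expR (- w))%:E * (ppow a (w - y) * ppow b (y - 0))%:E.
  by rewrite subr0 -EFinM mulrC.
have fDE (x y : R) :
    (ppow b y * expR (- y))%:E * (ppow a x * expR (- x))%:E = f (x + y)%R y.
  by rewrite -EFinM /f addrK opprD expRD; congr EFin; ring.
transitivity (\int[mu]_w \int[mu]_y f w y); last first.
  rewrite /eGamma -ge0_integralZl//=; [|exact: mg|exact: eBeta_ge0].
  apply: eq_integral => w _.
  transitivity (\int[mu]_y ((expR (- w))%:E * (ppow a (w - y) * ppow b (y - 0))%:E)).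
    by apply: eq_integral => y _; exact: fE.
  rewrite ge0_integralZl//=.
  - by rewrite integral_ppow_conv subr0 EFinM muleC -muleA.
  - exact: measurable_ppow_conv.
  - by move=> y _; rewrite lee_fin mulr_ge0// ppow_ge0.
rewrite (@fubini_tonelli _ _ _ _ _ mu mu (fun z => f z.1 z.2))//=.
rewrite /eGamma -ge0_integralZl//=; [|exact: mg|exact: integral_ge0].
apply: eq_integral => y _.
rewrite muleC -ge0_integralZl//=; last exact: mg.
rewrite -[RHS](@ge0_integral_translate (f^~ y) y)//=; last first.
  exact: (measurable_fun_pair1 y mf2).
by apply: eq_integral => x _; exact: fDE.
Qed.

End gamma_beta.

Section powR_order.
Context (R : realType).
Implicit Types r x y : R.

Lemma ltr_powRp r x y : 0 < r -> 0 <= x -> 0 <= y ->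
  (x `^ r < y `^ r) = (x < y).
Proof.
move=> r0 x0 y0; have [xy|yx|->] := ltgtP x y; last exact: ltxx.
  exact: gt0_ltr_powR.
by apply/negbTE; rewrite -leNgt ge0_ler_powR ?nnegrE// ltW.
Qed.

Lemma ltr_powRn r x y : r < 0 -> 0 < x -> 0 < y ->
  (x `^ r < y `^ r) = (y < x).
Proof.
move=> r0 x0 y0; rewrite -(opprK r) !(powRN _ (- r)) ltf_pV2 ?posrE ?powR_gt0//.
by rewrite ltr_powRp ?oppr_gt0// ltW.
Qed.

End powR_order.

(** * Finiteness and positivity of Gamma *)

Section gamma_finite.
Context (R : realType).
Notation mu := (@lebesgue_measure R).
Local Open Scope ereal_scope.

Lemma measurable_normr_powR (g : R) : measurable_fun setT (fun x : R => `|x| `^ g)%R.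
Proof. exact: (measurableT_comp (@measurable_powR R g) (@normr_measurable R setT)). Qed.

(** The substitution [u = x^g] turns the singular integrand into a constant. *)
Lemma integral_powR_lt_pinfty (g r : R) : (0 < g)%R -> (0 < r)%R ->
  \int[mu]_(x in `]0%R, r]) (x `^ (g - 1))%:E < +oo.
Proof.
move=> g0 r0.
have mI : measurable_fun setT (fun u : R => (\1_(`]-oo, (r `^ g)%R]) u : R)%:E).
  by apply/measurable_EFinP; exact: measurable_indic.
have I0 (u : R) : 0 <= (\1_(`]-oo, (r `^ g)%R]%classic) u : R)%:E by rewrite lee_fin.
have := @ge0_integral_powR R g _ (lt0r_neq0 g0) mI I0.
set lhs := LHS => lhsE.
have : lhs = g%:E * \int[mu]_(x in `]0%R, r]) (x `^ (g - 1))%:E.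
  rewrite -ge0_integralZl//=; last 3 first.
  - by apply/measurable_EFinP; apply: measurable_funTS; exact: measurable_powR.
  - by move=> x _; rewrite lee_fin powR_ge0.
  - by rewrite lee_fin ltW.
  rewrite [RHS]integral_mkcond /lhs [LHS]integral_mkcond; apply: eq_integral => x _.
  have K (y : R) : (((fun x : R => (\1_(`]-oo, (r `^ g)%R]%classic) (x `^ g)%R : R)%:E
      * (`|g| * x `^ (g - 1))%:E) \_ `]0%R, +oo[) y
    = ((fun x => g%:E * (x `^ (g - 1))%:E) \_ `]0%R, r]) y).
    rewrite !patchE !mem_setE !in_itv/= andbT; case: ltP => //= y0.
    rewrite indicE mem_setE in_itv/= !leNgt ltr_powRp ?ltW// gtr0_norm//.
    by case: ifPn; rewrite ?mul1e ?mul0e.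
  exact: K.
have lty : lhs < +oo.
  rewrite lhsE integral_indic//.
  rewrite (_ : _ `&` _ = `]0%R, (r `^ g)%R]%classic); last first.
    by apply/seteqP; split => x /=; rewrite !in_itv/=; lra.
  by rewrite /= lebesgue_measure_itv/= lte_fin powR_gt0// -EFinD ltry.
move=> E; move: lty; rewrite E.
set I := \int[mu]_(x in _) _.
have : 0 <= I by apply: integral_ge0 => x _; rewrite lee_fin powR_ge0.
by case: I => [s||]//= _; rewrite ?ltry// gt0_muley// lte_fin.
Qed.

Lemma ge0_integral_split0 (f : R -> \bar R) : measurable_fun setT f ->
  (forall x, 0 <= f x) ->
  \int[mu]_x f x = \int[mu]_(x in `]-oo, 0%R[) f x + \int[mu]_(x in `]0%R, +oo[) f x.
Proof.
move=> mf f0; rewrite (_ : setT = `]-oo, 0%R[%classic `|` `[0%R, +oo[%classic); last first.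
  by apply/seteqP; split => x //= _; rewrite !in_itv/= andbT; case: (ltP x 0%R); [left|right].
rewrite ge0_integral_setU//=.
- by congr (_ + _); rewrite integral_itv_obnd_cbnd//; exact: measurable_funTS.
- exact: measurable_funTS.
- by apply/disj_setPS => x /=; rewrite !in_itv/= andbT => -[]; lra.
Qed.

Lemma ge0_integral_opp (f : R -> \bar R) : measurable_fun setT f ->
  (forall x, 0 <= f x) ->
  \int[mu]_(x in `]-oo, 0%R[) f x = \int[mu]_(x in `]0%R, +oo[) f (- x)%R.
Proof.
move=> mf f0; rewrite [LHS]integral_mkcond [RHS]integral_mkcond.
rewrite -(@ge0_integral_affine _ (-1) 0)//=; last 2 first.
- apply/(measurable_restrictT _ _).1 => //; exact: measurable_funTS.
- by move=> x; rewrite patchE; case: ifPn.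
apply: eq_integral => x _; rewrite normrN1 mule1 addr0.
have K (y : R) : (f \_ `]-oo, 0%R[) (-1 * y)%R = ((fun x => f (- x)%R) \_ `]0%R, +oo[) y.
  by rewrite mulN1r !patchE !mem_setE !in_itv/= andbT oppr_lt0.
exact: K.
Qed.

Lemma eGamma_gt0 (g : R) : (0 < g)%R -> 0 < eGamma g.
Proof.
move=> g0.
have c0 : (0 < 2^-1 * expR (-2) :> R)%R by rewrite mulr_gt0 ?invr_gt0// expR_gt0.
apply: (@lt_le_trans _ _ (\int[mu]_(x in `]1%R, 2%R]) (2^-1 * expR (-2))%R%:E)).
  rewrite integral_cst//= lebesgue_measure_itv/= lte_fin ltr1n.
  by rewrite -EFinD -EFinM lte_fin mulr_gt0// subr_gt0 ltr1n.
rewrite integral_mkcond; apply: ge0_le_integral => //=.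
- by move=> x _; rewrite patchE; case: ifPn => // _; rewrite lee_fin ltW.
- by apply/(measurable_restrictT _ _).1.
- apply/measurable_EFinP; apply: measurable_funM; first exact: measurable_ppow.
  by apply: measurableT_comp; [exact: measurable_expR|exact: measurable_funN].
have K (x : R) : (((fun=> (2^-1 * expR (-2))%:E) \_ `]1%R, 2%R]) x
    <= (ppow g x * expR (- x))%:E).
  rewrite patchE mem_setE in_itv/=; case: ifPn => [/andP[x1 x2]|_]; last first.
    by rewrite lee_fin mulr_ge0 ?ppow_ge0// expR_ge0.
  have x0 : (0 < x)%R by lra.
  rewrite lee_fin ler_pM ?expR_ge0 ?invr_ge0//; last by rewrite ler_expR lerN2.
  rewrite /ppow x0 (@le_trans _ _ (x `^ (-1)))%R//.
    by rewrite powR_inv1 ?(ltW x0)// lef_pV2 ?posrE//.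
  by rewrite ler_powR//; lra.
by move=> x _; exact: K.
Qed.

(** Below 1 the integrand is dominated by the power, above 1 by an exponential
    density of rate 1/2. *)
Lemma eGamma_lt_pinfty (g : R) : (0 < g)%R -> eGamma g < +oo.
Proof.
move=> g0.
pose c : R := ((2 * g) `^ g)%R.
have g20 : (0 < 2 * g)%R by rewrite mulr_gt0.
(* For [x > 1], [x^(g-1) <= x^g = (2g)^g (x/(2g))^g <= (2g)^g exp (x/2)]. *)
have K (x : R) : (0 < x)%R -> ((x `^ (g - 1) * expR (- x))%:E <=
    ((fun x => (x `^ (g - 1))%:E) \_ `]0%R, 1%R]) x
    + (2 * c)%:E * (exponential_pdf 2^-1 x)%:E).
  move=> x0; rewrite patchE mem_setE in_itv/= x0/=.
  have e0 : (0 <= 2 * c * exponential_pdf 2^-1 x)%R.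
    by rewrite !mulr_ge0 ?powR_ge0// exponential_pdf_ge0 ?invr_ge0.
  case: ifPn => [x1|]; rewrite -EFinM -EFinD lee_fin.
    rewrite -[leLHS]addr0 lerD// ler_piMr ?powR_ge0// -[leRHS]expR0 ler_expR.
    by rewrite oppr_le0 ltW.
  rewrite -ltNge add0r => x1.
  rewrite exponential_pdfE ?(ltW x0)//.
  have -> : (2 * c * (2^-1 * expR (- 2^-1 * x)) = c * expR (x / 2) * expR (- x))%R.
    rewrite -[RHS]mulrA -expRD mulrACA mulfV// mul1r; congr (_ * expR _)%R; lra.
  rewrite ler_pM2r ?expR_gt0//.
  rewrite (@le_trans _ _ (x `^ g))%R//; first by rewrite ler_powR//; lra.
  have y0 : (0 <= x / (2 * g))%R by rewrite ltW// divr_gt0.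
  have -> : (x = (2 * g) * (x / (2 * g)))%R by rewrite mulrC divfK// gt_eqF.
  rewrite powRM ?(ltW g20)// ler_pM2l ?powR_gt0//.
  have -> : ((2 * g * (x / (2 * g))) / 2 = (x / (2 * g)) * g)%R.
    by field; rewrite gt_eqF.
  rewrite expRM ge0_ler_powR ?nnegrE ?expR_ge0 ?(ltW g0)//.
  by rewrite (le_trans _ (expR_ge1Dx _))// lerDr.
rewrite /eGamma.
have -> : \int[mu]_x (ppow g x * expR (- x))%:E =
    \int[mu]_(x in `]0%R, +oo[) (x `^ (g - 1) * expR (- x))%:E.
  rewrite [RHS]integral_mkcond; apply: eq_integral => x _.
  have E (y : R) : (ppow g y * expR (- y))%:E =
    ((fun x => (x `^ (g - 1) * expR (- x))%:E) \_ `]0%R, +oo[) y.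
    by rewrite patchE mem_setE in_itv/= andbT /ppow; case: ifPn; rewrite ?mul0r.
  exact: E.
have mp : measurable_fun setT (((fun x : R => (x `^ (g - 1))%:E) \_ `]0%R, 1%R])).
  apply/(measurable_restrictT _ _).1 => //.
  by apply/measurable_EFinP; apply: measurable_funTS; exact: measurable_powR.
have me : measurable_fun setT (fun x : R => (2 * c)%:E * (exponential_pdf 2^-1 x)%:E).
  apply/measurable_EFinP; apply: measurable_funM => //.
  exact: measurable_exponential_pdf.
have p0 (x : R) : 0 <= ((fun x => (x `^ (g - 1))%:E) \_ `]0%R, 1%R]) x.
  by rewrite patchE; case: ifPn => // _; rewrite lee_fin powR_ge0.
have e0 (x : R) : 0 <= (2 * c)%:E * (exponential_pdf 2^-1 x)%:E.
  by rewrite mule_ge0// lee_fin ?mulr_ge0 ?powR_ge0// exponential_pdf_ge0 ?invr_ge0.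
apply: (@le_lt_trans _ _ (\int[mu]_x (((fun x => (x `^ (g - 1))%:E) \_ `]0%R, 1%R]) x
    + (2 * c)%:E * (exponential_pdf 2^-1 x)%:E))).
  rewrite integral_mkcond; apply: ge0_le_integral => //=.
  - move=> x _; rewrite patchE; case: ifPn => // _.
    by rewrite lee_fin mulr_ge0 ?powR_ge0 ?expR_ge0.
  - apply/(measurable_restrictT _ _).1 => //; apply/measurable_EFinP.
    apply: measurable_funTS; apply: measurable_funM; first exact: measurable_powR.
    by apply: measurableT_comp; [exact: measurable_expR|exact: measurable_funN].
  - exact: emeasurable_funD.
  - move=> x _; rewrite patchE; case: ifPn => [|_]; last by rewrite adde_ge0// ?p0 ?e0.
    by rewrite mem_setE in_itv/= andbT => /K.
rewrite ge0_integralD//= lte_add_pinfty//.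
  by rewrite -integral_mkcond integral_powR_lt_pinfty.
rewrite ge0_integralZl//=; last 3 first.
- by apply/measurable_EFinP; exact: measurable_exponential_pdf.
- by move=> x _; rewrite lee_fin exponential_pdf_ge0 ?invr_ge0.
- by rewrite lee_fin mulr_ge0 ?powR_ge0.
by rewrite integral_exponential_pdf ?invr_gt0// mule1 ltry.
Qed.

Lemma GammaE (g : R) : Gamma g = fine (eGamma g).
Proof.
rewrite /Gamma /Rintegral /eGamma integral_mkcond; congr fine.
apply: eq_integral => x _.
have E (y : R) :
    ((fun x => (x `^ (g - 1) * expR (- x))%:E) \_ `]0%R, +oo[) y = (ppow g y * expR (- y))%:E.
  by rewrite patchE mem_setE in_itv/= andbT /ppow; case: ifPn; rewrite ?mul0r.
exact: E.
Qed.

Lemma EFin_Gamma (g : R) : (0 < g)%R -> (Gamma g)%:E = eGamma g.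
Proof.
move=> g0; rewrite GammaE fineK// ge0_fin_numE ?eGamma_lt_pinfty//.
exact/ltW/eGamma_gt0.
Qed.

Lemma Gamma_gt0 (g : R) : (0 < g)%R -> (0 < Gamma g)%R.
Proof. by move=> g0; rewrite -lte_fin EFin_Gamma// eGamma_gt0. Qed.

(** As Gamma is finite and positive, the product formula also shows that the Beta
    integral is finite. *)
Lemma eBetaE (a b : R) : (0 < a)%R -> (0 < b)%R ->
  eBeta a b = (Gamma a * Gamma b / Gamma (a + b))%:E.
Proof.
move=> a0 b0; have ab0 : (0 < a + b)%R by rewrite addr_gt0.
have G0 := Gamma_gt0 ab0.
have := eGammaM a b; rewrite -!EFin_Gamma//; have := eBeta_ge0 a b.
case: (eBeta a b) => [r _|_|//].
  by rewrite -!EFinM => -[->]; rewrite mulfK// gt_eqF.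
by rewrite gt0_mulye ?lte_fin.
Qed.

End gamma_finite.

(** * Signed powers and their Jacobian *)

Section signed_power.
Context (R : realType).
Notation mu := (@lebesgue_measure R).

(** [e = 1] and [e = -1] give the even and the odd extension of the power to
    negative numbers, hence all integer powers. Off the origin, the derivative
    of [spow e rho] is [rho * spow (- e) (rho - 1)]. *)
Definition spow (e p x : R) : R := `|x| `^ p * (if 0 <= x then 1 else e).

Lemma measurable_spow e p : measurable_fun setT (spow e p).
Proof.
apply: measurable_funM; first exact: measurable_normr_powR.
apply: measurable_fun_ifT => //.
exact: measurable_fun_ler.
Qed.

Lemma gt0_spow e p x : 0 < x -> spow e p x = x `^ p.
Proof. by move=> x0; rewrite /spow gtr0_norm// ltW// mulr1. Qed.

Lemma lt0_spow e p x : x < 0 -> spow e p x = e * (- x) `^ p.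
Proof. by move=> x0; rewrite /spow ltr0_norm// leNgt x0 mulrC. Qed.

Lemma spow0 e p : p != 0 -> spow e p 0 = 0.
Proof. by move=> p0; rewrite /spow normr0 powR0// mul0r. Qed.

Lemma norm_spow e p x : `|e| = 1 -> `|spow e p x| = `|x| `^ p.
Proof.
move=> e1; rewrite /spow normrM (ger0_norm (powR_ge0 _ _)).
by case: ifP; rewrite ?e1 ?normr1 mulr1.
Qed.

Local Open Scope ereal_scope.
Variables (e rho : R).
Hypotheses (e1 : `|e|%R = 1%R) (rho0 : (rho != 0)%R).
Local Notation G := (spow e rho).
Local Notation D := (spow (- e) (rho - 1)).

Let measG (F : R -> \bar R) : measurable_fun setT F ->
  measurable_fun setT (fun x => F (G x) * (`|rho * D x|)%:E).
Proof.
move=> mF; apply: emeasurable_funM.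
  by apply: measurableT_comp => //; exact: measurable_spow.
apply/measurable_EFinP; apply: measurableT_comp => //.
by apply: measurable_funM => //; exact: measurable_spow.
Qed.

Lemma normD (x : R) : `|rho * D x|%R = (`|rho| * `|x| `^ (rho - 1))%R.
Proof. by rewrite normrM norm_spow// normrN. Qed.

Lemma ge0_integral_spow_gt0 (F : R -> \bar R) :
  measurable_fun setT F -> (forall x, 0 <= F x) ->
  \int[mu]_(x in `]0%R, +oo[) (F (G x) * (`|rho * D x|)%:E)
  = \int[mu]_(x in `]0%R, +oo[) F x.
Proof.
move=> mF F0; rewrite -[RHS](ge0_integral_powR rho0)//.
apply: eq_integral => x; rewrite inE/= in_itv/= andbT => x0.
have K (y : R) : (0 < y)%R -> F (G y) * (`|rho * D y|)%:E
    = F (y `^ rho)%R * (`|rho| * y `^ (rho - 1))%:E.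
  by move=> y0; rewrite normD gt0_spow// (gtr0_norm y0).
exact: K.
Qed.

Lemma ge0_integral_spow_lt0 (F : R -> \bar R) :
  measurable_fun setT F -> (forall x, 0 <= F x) ->
  \int[mu]_(x in `]-oo, 0%R[) (F (G x) * (`|rho * D x|)%:E)
  = \int[mu]_(x in `]0%R, +oo[) F (e * x)%R.
Proof.
move=> mF F0; rewrite ge0_integral_opp//; last 2 first.
- exact: measG.
- by move=> x; rewrite mule_ge0.
rewrite -[RHS](ge0_integral_powR rho0)//; last first.
  by apply: measurableT_comp => //; exact: measurable_funM.
apply: eq_integral => x; rewrite inE/= in_itv/= andbT => x0.
have K (y : R) : (0 < y)%R -> F (G (- y)) * (`|rho * D (- y)|)%:E
    = F (e * y `^ rho)%R * (`|rho| * y `^ (rho - 1))%:E.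
  by move=> y0; rewrite normD lt0_spow ?oppr_lt0// normrN (gtr0_norm y0) opprK.
exact: K.
Qed.

(** The weight [|rho D|] is the Jacobian of [G] on each half-line, and [G] is
    injective there: an integral over the line is at most doubled. *)
Lemma ge0_integral_spow_le (F : R -> \bar R) :
  measurable_fun setT F -> (forall x, 0 <= F x) ->
  \int[mu]_x (F (G x) * (`|rho * D x|)%:E) <= \int[mu]_x F x + \int[mu]_x F x.
Proof.
move=> mF F0; rewrite ge0_integral_split0; last 2 first.
- exact: measG.
- by move=> x; rewrite mule_ge0.
rewrite ge0_integral_spow_gt0// ge0_integral_spow_lt0// leeD//.
  rewrite -[leRHS](@ge0_integral_affine _ e 0)//; last by rewrite -normr_eq0 e1 oner_eq0.
  rewrite e1; under [leRHS]eq_integral do rewrite addr0 mule1.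
  apply: ge0_subset_integral => //.
  by apply: measurableT_comp => //; exact: measurable_funM.
exact: ge0_subset_integral.
Qed.

Lemma integral_norm_powR_lt_pinfty (g L : R) : (0 < g)%R ->
  \int[mu]_x ((fun v : R => (`|v| `^ (g - 1))%:E) \_ `[(- L)%R, L]) x < +oo.
Proof.
move=> g0; set f := (f in \int[mu]_x f x).
have mf : measurable_fun setT f.
  apply/(measurable_restrictT _ _).1 => //; apply/measurable_EFinP.
  by apply: measurable_funTS; exact: measurable_normr_powR.
have f0 x : 0 <= f x.
  by rewrite /f patchE; case: ifPn => // _; rewrite lee_fin powR_ge0.
have fN x : f (- x)%R = f x.
  by rewrite /f !patchE !mem_setE !in_itv/= normrN lerN2 lerNl andbC.
have Lp : \int[mu]_(x in `]0%R, +oo[) f x < +oo.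
  rewrite integral_mkcond.
  have L0 : (0 < Num.max L 1)%R by rewrite lt_max ltr01 orbT.
  apply: le_lt_trans (integral_powR_lt_pinfty g0 L0).
  rewrite [leRHS]integral_mkcond.
  apply: ge0_le_integral => //.
  - by move=> x _; rewrite patchE; case: ifPn.
  - by apply/(measurable_restrictT _ _).1 => //; exact: measurable_funTS.
  - apply/(measurable_restrictT _ _).1 => //; apply/measurable_EFinP.
    by apply: measurable_funTS; exact: measurable_powR.
  have K (x : R) : (f \_ `]0%R, +oo[) x <=
      ((fun x => (x `^ (g - 1))%:E) \_ `]0%R, (Num.max L 1)%R]) x.
    rewrite /f !patchE !mem_setE !in_itv/= andbT; case: ltP => //= x0.
    rewrite (le_max x); case: ifPn => [/andP[_ ->]/=|_].
      by rewrite gtr0_norm.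
    by case: ifPn => // _; rewrite lee_fin powR_ge0.
  by move=> x _; exact: K.
rewrite ge0_integral_split0// ge0_integral_opp//.
rewrite (_ : \int[mu]_(x in _) f (- x)%R = \int[mu]_(x in `]0%R, +oo[) f x).
  by rewrite lte_add_pinfty.
by apply: eq_integral => x _; exact: fN.
Qed.

End signed_power.

(** * Almost everywhere finiteness of iterated integrals *)

Section kernel_operator.
Context (R : realType).
Notation mu := (@lebesgue_measure R).
Local Open Scope ereal_scope.
Variables (k : R * R -> R) (d : R -> R) (M : R).
Hypotheses (mk : measurable_fun setT k) (md : measurable_fun setT d).
Hypotheses (k0 : forall z, (0 <= k z)%R) (d0 : forall x, (0 <= d x)%R).
Hypothesis kM : forall s, \int[mu]_t (k (t, s) * d t)%:E <= M%:E.

Definition kop (w : R -> \bar R) (t : R) : \bar R :=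
  (d t)%:E * \int[mu]_s ((k (t, s))%:E * w s).

Lemma measurable_kop_fun (w : R -> \bar R) : measurable_fun setT w ->
  measurable_fun setT (fun z : R * R => (k z)%:E * w z.2).
Proof.
move=> mw; apply: emeasurable_funM; first exact/measurable_EFinP.
by apply: measurableT_comp => //; exact: measurable_snd.
Qed.

Lemma kop_ge0 w : (forall x, 0 <= w x) -> forall t, 0 <= kop w t.
Proof.
move=> w0 t; rewrite mule_ge0 ?lee_fin//; apply: integral_ge0 => s _.
by rewrite mule_ge0// lee_fin.
Qed.

Lemma measurable_kop w : measurable_fun setT w -> (forall x, 0 <= w x) ->
  measurable_fun setT (kop w).
Proof.
move=> mw w0; apply: emeasurable_funM; first exact/measurable_EFinP.
apply: (@measurable_fun_fubini_tonelli_F _ _ _ _ _ mu (fun z => (k z)%:E * w z.2)).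
  exact: measurable_kop_fun.
by move=> z; rewrite mule_ge0// lee_fin.
Qed.

(** By Tonelli, a bound on the integrals of the kernel in its first variable
    bounds the operator on nonnegative integrable functions. *)
Lemma integral_kop_le w : measurable_fun setT w -> (forall x, 0 <= w x) ->
  \int[mu]_t kop w t <= M%:E * \int[mu]_s w s.
Proof.
move=> mw w0.
pose f (z : R * R) := (d z.1)%:E * ((k z)%:E * w z.2).
have mf : measurable_fun setT f.
  apply: emeasurable_funM; last exact: measurable_kop_fun.
  by apply/measurable_EFinP; apply: measurableT_comp => //; exact: measurable_fst.
have f0 z : 0 <= f z by rewrite !mule_ge0// lee_fin.
have M0 : (0 <= M)%R.
  rewrite -lee_fin; apply: le_trans (kM 0%R).
  by apply: integral_ge0 => t _; rewrite lee_fin mulr_ge0.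
rewrite (_ : \int[mu]_t kop w t = \int[mu]_t \int[mu]_s f (t, s)); last first.
  apply: eq_integral => t _; rewrite /kop -ge0_integralZl//=.
  - exact: (measurable_fun_pair2 t (measurable_kop_fun mw)).
  - by move=> s _; rewrite mule_ge0// lee_fin.
  - by rewrite lee_fin.
rewrite (@fubini_tonelli _ _ _ _ _ mu mu f)//.
rewrite -ge0_integralZl//=.
apply: ge0_le_integral => //=.
- by move=> s _; apply: integral_ge0.
- exact: (measurable_fun_fubini_tonelli_G (m1 := mu) f).
- by apply: emeasurable_funM.
move=> s _.
rewrite (_ : \int[mu]_t f (t, s) = w s * \int[mu]_t (k (t, s) * d t)%:E).
  by rewrite muleC lee_wpmul2r.
rewrite -ge0_integralZl//=.
- by apply: eq_integral => t _; rewrite /f/= muleCA muleA muleC EFinM.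
- apply/measurable_EFinP; apply: measurable_funM => //.
  exact: (measurable_fun_pair1 s mk).
- by move=> t _; rewrite lee_fin mulr_ge0.
Qed.

End kernel_operator.

Section power_kernel.
Context (R : realType).
Notation mu := (@lebesgue_measure R).
Local Open Scope ereal_scope.
Variables (e rho L : R) (J : set R).
Hypotheses (e1 : `|e|%R = 1%R) (rho0 : (rho != 0)%R) (mJ : measurable J).
Local Notation G := (spow e rho).
Local Notation D := (spow (- e) (rho - 1)).
Hypothesis JL : forall x, J x -> (`|G x| <= L)%R.

(** The modulus of the fractional kernel, cut off to the set [J] on which [G] is
    bounded. *)
Definition pker (g : R) (z : R * R) : R :=
  (\1_J z.1 * \1_J z.2 * `|G z.1 - G z.2| `^ (g - 1))%R.

Lemma pker_ge0 g z : (0 <= pker g z)%R.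
Proof. by rewrite /pker !mulr_ge0// powR_ge0. Qed.

Lemma measurable_pker g : measurable_fun setT (pker g).
Proof.
have mI : measurable_fun setT (\1_J : R -> R) by exact: measurable_indic.
apply: measurable_funM; first apply: measurable_funM.
- by apply: measurableT_comp => //; exact: measurable_fst.
- by apply: measurableT_comp => //; exact: measurable_snd.
apply: (measurableT_comp (measurable_normr_powR (g - 1))).
apply: measurable_funB; (apply: measurableT_comp; first exact: measurable_spow).
- exact: measurable_fst.
- exact: measurable_snd.
Qed.

(** In the variable [u = G t] the kernel is [|u - G s|^(g-1)] on a bounded set,
    which is integrable uniformly in [s] because [g > 0]. *)
Lemma pker_bound (g : R) : (0 < g)%R -> exists M : R, forall s,
  \int[mu]_t (pker g (t, s) * `|rho * D t|)%:E <= M%:E.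
Proof.
move=> g0.
pose f := (fun v : R => (`|v| `^ (g - 1))%:E) \_ `[(- (2 * L))%R, (2 * L)%R].
have mf : measurable_fun setT f.
  apply/(measurable_restrictT _ _).1 => //; apply/measurable_EFinP.
  by apply: measurable_funTS; exact: measurable_normr_powR.
have f0 x : 0 <= f x.
  by rewrite /f patchE; case: ifPn => // _; rewrite lee_fin powR_ge0.
have fy : \int[mu]_x f x < +oo by exact: integral_norm_powR_lt_pinfty.
have ffin : \int[mu]_x f x \is a fin_num.
  by rewrite ge0_fin_numE//; exact: integral_ge0.
exists (fine (\int[mu]_x f x) + fine (\int[mu]_x f x))%R => s.
rewrite EFinD fineK//.
have -> : \int[mu]_x f x = \int[mu]_x f (x - G s)%R.
  by rewrite (@ge0_integral_translate _ f (- G s)%R).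
have mfs : measurable_fun setT (fun x : R => f (x - G s)%R).
  by apply: measurableT_comp => //; exact: measurable_funD.
apply: le_trans (ge0_integral_spow_le e1 rho0 mfs _) => //.
apply: ge0_le_integral => //=.
- by move=> t _; rewrite lee_fin mulr_ge0// pker_ge0.
- apply/measurable_EFinP; apply: measurable_funM.
    exact: (measurable_fun_pair1 s (measurable_pker g)).
  apply: measurableT_comp => //.
  by apply: measurable_funM => //; exact: measurable_spow.
- apply: emeasurable_funM.
    by apply: (measurableT_comp mfs); exact: measurable_spow.
  apply/measurable_EFinP; apply: measurableT_comp => //.
  by apply: measurable_funM => //; exact: measurable_spow.
have K (t : R) : (pker g (t, s) * `|rho * D t|)%:E <= f (G t - G s)%R * `|rho * D t|%:E.
  rewrite EFinM lee_wpmul2r// /pker/= !indicE.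
  have [tJ|_] := boolP (t \in J); last by rewrite !mul0r.
  have [sJ|_] := boolP (s \in J); last by rewrite mulr0 mul0r.
  rewrite !mul1r /f patchE mem_setE in_itv/= -ler_norml ifT//.
  rewrite inE in tJ; rewrite inE in sJ.
  by rewrite (le_trans (ler_normB _ _))// mulr2n mulrDl mul1r lerD// JL.
by move=> t _; exact: K.
Qed.

Local Notation d := (fun x : R => `|rho * D x|%R).

(** Weighting by [|rho D|] makes a power kernel a bounded operator on integrable
    functions. *)
Lemma pker_op_lt_pinfty (g : R) (w : R -> \bar R) : (0 < g)%R ->
  measurable_fun setT w -> (forall x, 0 <= w x) -> \int[mu]_x w x < +oo ->
  \int[mu]_t kop (pker g) d w t < +oo.
Proof.
move=> g0 mw w0 wy; have [M kM] := pker_bound g0.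
have md : measurable_fun setT d.
  apply: measurableT_comp => //.
  by apply: measurable_funM => //; exact: measurable_spow.
apply: le_lt_trans (integral_kop_le (measurable_pker g) md _ _ kM mw w0) _ => //.
  exact: pker_ge0.
have : \int[mu]_x w x \is a fin_num.
  by rewrite ge0_fin_numE//; exact: integral_ge0.
by move=> /fineK <-; rewrite -EFinM ltry.
Qed.

Lemma measurable_pker_op g (w : R -> \bar R) :
  measurable_fun setT w -> (forall x, 0 <= w x) ->
  measurable_fun setT (kop (pker g) d w).
Proof.
move=> mw w0; apply: measurable_kop => //; first exact: measurable_pker.
- apply: measurableT_comp => //.
  by apply: measurable_funM => //; exact: measurable_spow.
- exact: pker_ge0.
Qed.

(** The weight [|rho D|] vanishes at most at the origin, so that finiteness of the
    weighted integral is finiteness of the integral itself. *)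
Lemma ae_pker_lt_pinfty (g : R) (w : R -> \bar R) : (0 < g)%R ->
  measurable_fun setT w -> (forall x, 0 <= w x) -> \int[mu]_x w x < +oo ->
  {ae mu, forall t, t != 0%R -> \int[mu]_s ((pker g (t, s))%:E * w s) < +oo}.
Proof.
move=> g0 mw w0 wy.
have d0 x : (0 <= d x)%R by [].
have k0 := @kop_ge0 _ _ d (@pker_ge0 g) d0 w w0.
have : mu.-integrable setT (kop (pker g) d w).
  apply/integrableP; split; first exact: measurable_pker_op.
  by under eq_integral do rewrite gee0_abs//; exact: pker_op_lt_pinfty.
move/integrable_ae => /(_ measurableT); apply: filterS => t /= /(_ I) tfin t0.
move: tfin; rewrite /kop ge0_fin_numE; last exact: k0.
have dt0 : (0 < `|rho * D t|)%R.
  by rewrite normr_gt0 mulf_neq0// -normr_eq0 norm_spow ?normrN// powR_eq0 normr_eq0 (negbTE t0).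
set I := integral _ _ _.
have : 0 <= I by apply: integral_ge0 => s _; rewrite mule_ge0// lee_fin pker_ge0.
by case: I => [r||]//= _; rewrite ?ltry// gt0_muley// lte_fin.
Qed.

End power_kernel.

Local Open Scope complex_scope.

(** * Complex-valued integrals *)

Section almost_everywhere.
Context (R : realType).
Notation mu := (@lebesgue_measure R).
Implicit Types P Q S : R -> Prop.

Lemma ae_imp P Q : (forall x, P x -> Q x) ->
  {ae mu, forall x, P x} -> {ae mu, forall x, Q x}.
Proof. exact: (@filterS _ _ (ae_filter_ringOfSetsType mu)). Qed.

Lemma ae_imp2 P Q S : (forall x, P x -> Q x -> S x) ->
  {ae mu, forall x, P x} -> {ae mu, forall x, Q x} -> {ae mu, forall x, S x}.
Proof. exact: (@filterS2 _ _ (ae_filter_ringOfSetsType mu)). Qed.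

Lemma ae_neq (c : R) : {ae mu, forall x, x != c}.
Proof.
exists [set c]; split; [exact: measurable_set1|exact: lebesgue_measure_set1|].
by move=> x /= /negP; rewrite negbK => /eqP.
Qed.

End almost_everywhere.

Section complex_parts.
Context (R : realType).
Implicit Types z w : R[i].

Lemma ReM z w :
  complex.Re (z * w) = complex.Re z * complex.Re w - complex.Im z * complex.Im w.
Proof. by case: z => a b; case: w. Qed.

Lemma ImM z w :
  complex.Im (z * w) = complex.Re z * complex.Im w + complex.Im z * complex.Re w.
Proof. by case: z => a b; case: w. Qed.

Lemma ReZ (r : R) z : complex.Re (r%:C * z) = r * complex.Re z.
Proof. by rewrite ReM/= mul0r subr0. Qed.

Lemma ImZ (r : R) z : complex.Im (r%:C * z) = r * complex.Im z.
Proof. by rewrite ImM/= mul0r addr0. Qed.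

(** A submultiplicative norm equivalent to the modulus, which avoids square
    roots. *)
Definition norm1 z : R := `|complex.Re z| + `|complex.Im z|.

Lemma norm1_ge0 z : 0 <= norm1 z. Proof. by rewrite addr_ge0. Qed.

Lemma norm1M z w : norm1 (z * w) <= norm1 z * norm1 w.
Proof.
rewrite /norm1 ReM ImM.
have := ler_normB (complex.Re z * complex.Re w) (complex.Im z * complex.Im w).
have := ler_normD (complex.Re z * complex.Im w) (complex.Im z * complex.Re w).
by rewrite !normrM; lra.
Qed.

Lemma norm1_real (r : R) : norm1 r%:C = `|r|.
Proof. by rewrite /norm1/= normr0 addr0. Qed.

Lemma complex_eqP z w : complex.Re z = complex.Re w -> complex.Im z = complex.Im w -> z = w.
Proof. by case: z => a b; case: w => c d /= -> ->. Qed.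

End complex_parts.

Section complex_measurable.
Context d (T : measurableType d) (R : realType).
Implicit Types f g : T -> R[i].

Definition cmeasurable f :=
  measurable_fun setT (fun x => complex.Re (f x)) /\
  measurable_fun setT (fun x => complex.Im (f x)).

Lemma cmeasurableM f g : cmeasurable f -> cmeasurable g ->
  cmeasurable (fun x => f x * g x).
Proof.
move=> [fr fi] [gr gi]; split.
  under eq_fun do rewrite ReM.
  by apply: measurable_funB; apply: measurable_funM.
under eq_fun do rewrite ImM.
by apply: measurable_funD; apply: measurable_funM.
Qed.

Lemma cmeasurable_real (r : T -> R) : measurable_fun setT r ->
  cmeasurable (fun x => (r x)%:C).
Proof. by move=> mr; split => //=. Qed.

Lemma cmeasurable_cpow (r : T -> R) p : measurable_fun setT r ->
  cmeasurable (fun x => cpow (r x) p).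
Proof.
move=> mr.
have ms (u v : R) : measurable_fun setT (fun x => `|r x| `^ p * if 0 <= r x then u else v).
  apply: measurable_funM.
    apply: (measurableT_comp (@measurable_powR R p)).
    exact: (measurableT_comp (@normr_measurable R setT)).
  by apply: measurable_fun_ifT => //; exact: measurable_fun_ler.
split.
  under eq_fun do rewrite /cpow ReZ (fun_if (@complex.Re R))/=.
  exact: ms.
under eq_fun do rewrite /cpow ImZ (fun_if (@complex.Im R))/=.
exact: ms.
Qed.

Lemma measurable_norm1 f : cmeasurable f -> measurable_fun setT (fun x => norm1 (f x)).
Proof. by move=> [fr fi]; apply: measurable_funD; apply: measurableT_comp. Qed.

Lemma cmeasurable_comp d' (T' : measurableType d') (h : T' -> T) f :
  cmeasurable f -> measurable_fun setT h ->
  measurable_fun setT (fun x => complex.Re (f (h x))) /\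
  measurable_fun setT (fun x => complex.Im (f (h x))).
Proof.
move=> [fr fi] mh; split.
- exact: (measurableT_comp fr mh).
- exact: (measurableT_comp fi mh).
Qed.

End complex_measurable.

Section complex_integral.
Context (R : realType).
Notation mu := (@lebesgue_measure R).
Implicit Types (f g : R -> R[i]) (c : R[i]) (A : set R).

Lemma Rintegral_indic A (f : R -> R) :
  Rintegral mu A f = Rintegral mu setT (fun x => \1_A x * f x).
Proof.
rewrite Rintegral_mkcond; apply: eq_Rintegral => x _.
have K (y : R) : (f \_ A) y = \1_A y * f y.
  by rewrite patchE indicE; case: ifPn; rewrite ?mul1r ?mul0r.
exact: K.
Qed.

Lemma integrable_indic_mul A (f : R -> R) : measurable A ->
  mu.-integrable A (fun x => (f x)%:E) <->
  mu.-integrable setT (fun x => (\1_A x * f x)%:E).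
Proof.
move=> mA.
have E : (fun x => (\1_A x * f x)%:E) = (fun x => (f x)%:E) \_ A.
  apply/funext => x; rewrite patchE indicE.
  by case: ifPn; rewrite ?mul1r ?mul0r.
rewrite E; exact: (@integrable_mkcond _ _ _ mu A _ mA).
Qed.

Lemma cintegral_indic A f :
  cintegral A f = cintegral setT (fun x => (\1_A x)%:C * f x).
Proof.
rewrite /cintegral; congr (_ +i* _); rewrite Rintegral_indic;
  by apply: eq_Rintegral => x _; rewrite ?ReZ ?ImZ.
Qed.

Lemma cintegrable_indic A f : measurable A ->
  cintegrable A f <-> cintegrable setT (fun x => (\1_A x)%:C * f x).
Proof.
move=> mA; rewrite /cintegrable.
have Er : (fun s => (complex.Re ((\1_A s)%:C * f s))%:E) =
    (fun s => (\1_A s * complex.Re (f s))%:E) by apply/funext => s; rewrite ReZ.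
have Ei : (fun s => (complex.Im ((\1_A s)%:C * f s))%:E) =
    (fun s => (\1_A s * complex.Im (f s))%:E) by apply/funext => s; rewrite ImZ.
rewrite Er Ei.
have Hr := integrable_indic_mul (fun s => complex.Re (f s)) mA.
have Hi := integrable_indic_mul (fun s => complex.Im (f s)) mA.
by split=> -[/Hr ? /Hi ?].
Qed.

Lemma eq_cintegral A f g : (forall x, A x -> f x = g x) -> cintegral A f = cintegral A g.
Proof.
move=> fg; rewrite /cintegral; congr (_ +i* _); apply: eq_Rintegral => x;
  by rewrite inE => Ax; rewrite fg.
Qed.

Lemma cintegral0 A f : (forall x, A x -> f x = 0) -> cintegral A f = 0.
Proof.
move=> f0; rewrite (@eq_cintegral _ _ (fun=> 0))//.
by rewrite /cintegral /Rintegral/= integral0.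
Qed.

Lemma cintegrableZ c f : cintegrable setT f -> cintegrable setT (fun x => c * f x).
Proof.
move=> [fr fi]; split.
- under eq_fun do rewrite ReM EFinB !EFinM.
  by apply: integrableB => //; apply: integrableZl.
- under eq_fun do rewrite ImM EFinD !EFinM.
  by apply: integrableD => //; apply: integrableZl.
Qed.

Lemma cintegralZ c f : cintegrable setT f ->
  cintegral setT (fun x => c * f x) = c * cintegral setT f.
Proof.
move=> [fr fi].
have iZ (r : R) (h : R -> R) : mu.-integrable setT (EFin \o h) ->
    mu.-integrable setT (EFin \o (fun x => r * h x)).
  by move=> ih; apply: (integrableZl measurableT r ih).
apply: complex_eqP; rewrite ?ReM ?ImM /cintegral/=.
- under eq_Rintegral do rewrite ReM.
  by rewrite RintegralB//; [rewrite !RintegralZl|exact: iZ|exact: iZ].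
- under eq_Rintegral do rewrite ImM.
  by rewrite RintegralD//; [rewrite !RintegralZl|exact: iZ|exact: iZ].
Qed.

(** A complex factor [c] comes out as soon as the product is integrable, since
    either [c] is invertible or both sides vanish. *)
Lemma cintegralZ_integrable c f : cintegrable setT (fun x => c * f x) ->
  cintegral setT (fun x => c * f x) = c * cintegral setT f.
Proof.
have [->|c0] := eqVneq c 0.
  by move=> _; rewrite mul0r cintegral0// => x _; rewrite mul0r.
move=> /(cintegrableZ c^-1); under eq_fun do rewrite mulKf//.
exact: cintegralZ.
Qed.

(** A nonnegative factor comes out even when the integral diverges: it scales
    the integrals of the positive and negative parts, and a divergent integral
    has real value zero. *)
Lemma RintegralZ_ge0 (r : R) (h : R -> R) : 0 <= r -> measurable_fun setT h ->
  Rintegral mu setT (fun x => r * h x) = r * Rintegral mu setT h.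
Proof.
move=> r0 mh; rewrite /Rintegral.
have mE : measurable_fun setT (EFin \o h) by exact/measurable_EFinP.
have [->|rn0] := eqVneq r 0.
  by rewrite mul0r integral0_eq// => x _; rewrite mul0r.
have rgt0 : 0 < r by rewrite lt_neqAle eq_sym rn0.
have -> : (\int[mu]_x (r * h x)%:E = r%:E * \int[mu]_x (h x)%:E)%E.
  rewrite (_ : (fun x => (r * h x)%:E) = (fun x => r%:E * (EFin \o h) x)%E)//.
  rewrite integralE [in RHS]integralE.
  rewrite ge0_funeposM// ge0_funenegM//.
  rewrite !ge0_integralZl//; last 2 first.
  - exact: (measurable_funeneg mE).
  - exact: (measurable_funepos mE).
  have : (0 <= \int[mu]_x ((EFin \o h)^\+ x))%E by exact: integral_ge0.
  have : (0 <= \int[mu]_x ((EFin \o h)^\- x))%E by exact: integral_ge0.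
  set y := integral _ _ _; set z := integral _ _ _.
  case: y => [y||]//; case: z => [z||]// _ _.
  - by rewrite -EFinB -!EFinM mulrBr EFinB.
  - by rewrite /= !(gt0_muley, gt0_muleNy) ?lte_fin.
  - by rewrite /= !(gt0_muley, gt0_muleNy) ?lte_fin.
  - by rewrite /= !(gt0_muley, gt0_muleNy) ?lte_fin.
case: (\int[mu]_x (h x)%:E)%E => [y||]//=.
- by rewrite gt0_muley ?lte_fin//= mulr0.
- by rewrite gt0_muleNy ?lte_fin//= mulr0.
Qed.

Lemma cintegralZ_ge0 (r : R) f : 0 <= r -> cmeasurable f ->
  cintegral setT (fun x => r%:C * f x) = r%:C * cintegral setT f.
Proof.
move=> r0 [mr mi]; apply: complex_eqP; rewrite ?ReZ ?ImZ /cintegral/=.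
- by under eq_Rintegral do rewrite ReZ; exact: RintegralZ_ge0.
- by under eq_Rintegral do rewrite ImZ; exact: RintegralZ_ge0.
Qed.

Lemma Rintegral_ae_eq (f g : R -> R) : measurable_fun setT f -> measurable_fun setT g ->
  {ae mu, forall x, f x = g x} -> Rintegral mu setT f = Rintegral mu setT g.
Proof.
move=> mf mg fg; congr fine; apply: ae_eq_integral => //.
- exact/measurable_EFinP.
- exact/measurable_EFinP.
- by apply: ae_imp fg => x -> _.
Qed.

Lemma cintegral_ae_eq f g : cmeasurable f -> cmeasurable g ->
  {ae mu, forall x, f x = g x} -> cintegral setT f = cintegral setT g.
Proof.
move=> [fr fi] [gr gi] fg.
by rewrite /cintegral; congr (_ +i* _); apply: Rintegral_ae_eq => //;
  apply: ae_imp fg => x ->.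
Qed.

Lemma norm1_cpow (x p : R) : norm1 (cpow x p) <= 2 * `|x| `^ p.
Proof.
rewrite /norm1 /cpow ReZ ImZ !normrM !(ger0_norm (powR_ge0 _ _)) -mulrDr mulrC.
rewrite ler_wpM2r ?powR_ge0//; case: ifP => _ /=.
  by rewrite normr1 normr0 addr0 ler1n.
have c1 : `|cos (p * pi)| <= 1 :> R by rewrite ler_norml cos_geN1 cos_le1.
have s1 : `|sin (p * pi)| <= 1 :> R by rewrite ler_norml sin_geN1 sin_le1.
lra.
Qed.

Lemma norm1_integrable f : cintegrable setT f ->
  mu.-integrable setT (fun x => (norm1 (f x))%:E).
Proof.
move=> [fr fi]; rewrite /norm1.
under eq_fun do rewrite EFinD.
by apply: integrableD => //; apply: integrable_norm.
Qed.

End complex_integral.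

Section complex_fubini.
Context (R : realType).
Notation mu := (@lebesgue_measure R).
Implicit Type f : R * R -> R[i].

(** The integral is the difference of those of the positive and negative parts,
    each of which is measurable in the parameter by Tonelli's theorem. *)
Lemma measurable_Rintegral_param (f : R * R -> R) : measurable_fun setT f ->
  measurable_fun setT (fun x => Rintegral mu setT (fun y => f (x, y))).
Proof.
move=> mf; rewrite /Rintegral.
have mE : measurable_fun setT (EFin \o f) by exact/measurable_EFinP.
apply: (measurableT_comp (@fine_measurable R setT measurableT)).
have mp : measurable_fun setT (fun x => \int[mu]_y (EFin \o f)^\+%E (x, y))%E.
  apply: (@measurable_fun_fubini_tonelli_F _ _ _ _ _ mu (EFin \o f)^\+%E).
    exact: measurable_funepos.
  exact: funepos_ge0.
have mn : measurable_fun setT (fun x => \int[mu]_y (EFin \o f)^\-%E (x, y))%E.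
  apply: (@measurable_fun_fubini_tonelli_F _ _ _ _ _ mu (EFin \o f)^\-%E).
    exact: measurable_funeneg.
  exact: funeneg_ge0.
rewrite (_ : (fun x => _) = (fun x => \int[mu]_y (EFin \o f)^\+%E (x, y)
  - \int[mu]_y (EFin \o f)^\-%E (x, y))%E); first exact: emeasurable_funB.
apply/funext => x; rewrite integralE; congr (_ - _)%E; apply: eq_integral => y _.
  by rewrite funeposE [RHS]funeposE.
by rewrite funenegE [RHS]funenegE.
Qed.

Lemma cmeasurable_cintegral_param f : cmeasurable f ->
  cmeasurable (fun x => cintegral setT (fun y => f (x, y))).
Proof.
move=> [fr fi]; split; rewrite /cintegral/=.
- exact: (measurable_Rintegral_param fr).
- exact: (measurable_Rintegral_param fi).
Qed.

Lemma Rintegral_Fubini (f : R * R -> R) :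
  (mu \x mu)%E.-integrable setT (EFin \o f) ->
  Rintegral mu setT (fun x => Rintegral mu setT (fun y => f (x, y))) =
  Rintegral mu setT (fun y => Rintegral mu setT (fun x => f (x, y))).
Proof.
move=> fi; have mf : measurable_fun setT f by apply/measurable_EFinP; exact: measurable_int fi.
have mE : measurable_fun setT (EFin \o f) by exact/measurable_EFinP.
have H1 : (\int[mu]_x (Rintegral mu setT (fun y => f (x, y)))%:E =
           \int[mu]_x \int[mu]_y (f (x, y))%:E)%E.
  apply: ae_eq_integral => //.
  - by apply/measurable_EFinP; exact: measurable_Rintegral_param.
  - exact: (measurable_fubini_F fi).
  apply: ae_imp (ae_integrable1 fi) => x xi _.
  by rewrite /Rintegral fineK//; exact: integrable_fin_num.
have H2 : (\int[mu]_y (Rintegral mu setT (fun x => f (x, y)))%:E =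
           \int[mu]_y \int[mu]_x (f (x, y))%:E)%E.
  apply: ae_eq_integral => //.
  - apply/measurable_EFinP.
    apply: (@measurable_Rintegral_param (fun z => f (z.2, z.1))).
    apply: (measurableT_comp mf).
    by apply: measurable_fun_pair; [exact: measurable_snd|exact: measurable_fst].
  - exact: (measurable_fubini_G fi).
  apply: ae_imp (ae_integrable2 fi) => x xi _.
  by rewrite /Rintegral fineK//; exact: integrable_fin_num.
rewrite {1}/Rintegral H1 {1}[in RHS]/Rintegral H2.
by congr fine; exact: (Fubini fi).
Qed.

Section dominated.
Variables (f : R * R -> R[i]) (b : R * R -> \bar R).
Hypotheses (mf : cmeasurable f) (mb : measurable_fun setT b).
Hypothesis fb : forall z, ((norm1 (f z))%:E <= b z)%E.
Hypothesis b_lty : (\int[mu]_x \int[mu]_y b (x, y) < +oo)%E.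

Let part_integrable (h : R * R -> R) : measurable_fun setT h ->
  (forall z, `|h z| <= norm1 (f z)) -> (mu \x mu)%E.-integrable setT (EFin \o h).
Proof.
move=> mh hf; have mE : measurable_fun setT (EFin \o h) by exact/measurable_EFinP.
apply/(integrable12ltyP mu mu mE); apply: le_lt_trans b_lty.
have hb z : (`|(h z)%:E| <= b z)%E by rewrite (le_trans _ (fb z))// lee_fin hf.
have b0 z : (0 <= b z)%E by exact: le_trans (hb z).
have ma : measurable_fun setT (abse \o (EFin \o h)) by exact: measurableT_comp.
have m1 : measurable_fun setT (fun x => \int[mu]_y (abse \o (EFin \o h)) (x, y))%E.
  apply: (@measurable_fun_fubini_tonelli_F _ _ _ _ _ mu (abse \o (EFin \o h))) => //.
  by move=> z; exact: abse_ge0.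
have m2 : measurable_fun setT (fun x => \int[mu]_y b (x, y))%E.
  exact: (@measurable_fun_fubini_tonelli_F _ _ _ _ _ mu b).
apply: ge0_le_integral; [by []|by move=> x _; exact: integral_ge0|exact: m1|exact: m2|].
move=> x _; apply: ge0_le_integral => //.
- exact: (measurable_fun_pair2 x ma).
- exact: (measurable_fun_pair2 x mb).
- by move=> y _; exact: hb.
Qed.

Let re_i : (mu \x mu)%E.-integrable setT (EFin \o (fun z => complex.Re (f z))).
Proof. by apply: (part_integrable mf.1) => z; rewrite /norm1 lerDl. Qed.

Let im_i : (mu \x mu)%E.-integrable setT (EFin \o (fun z => complex.Im (f z))).
Proof. by apply: (part_integrable mf.2) => z; rewrite /norm1 lerDr. Qed.

Lemma cintegral_Fubini :
  cintegral setT (fun x => cintegral setT (fun y => f (x, y))) =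
  cintegral setT (fun y => cintegral setT (fun x => f (x, y))).
Proof.
apply: complex_eqP.
- exact: (Rintegral_Fubini re_i).
- exact: (Rintegral_Fubini im_i).
Qed.

Lemma ae_cintegrable1 : {ae mu, forall x, cintegrable setT (fun y => f (x, y))}.
Proof.
by apply: ae_imp2 (ae_integrable1 re_i) (ae_integrable1 im_i) => x ? ?; split.
Qed.

Lemma ae_cintegrable2 : {ae mu, forall y, cintegrable setT (fun x => f (x, y))}.
Proof.
by apply: ae_imp2 (ae_integrable2 re_i) (ae_integrable2 im_i) => x ? ?; split.
Qed.

End dominated.
End complex_fubini.

(** * Oriented substitution *)

(** A substitution rule for nonnegative functions vanishing on [Z] passes to signed
    ones, whether or not they are integrable. *)
Section signed_transfer.
Context (R : realType).
Notation mu := (@lebesgue_measure R).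
Local Open Scope ereal_scope.
Variables (A : set R) (g h : R -> R) (Z : R -> Prop).
Hypothesis h0 : forall x, (0 <= h x)%R.
Hypothesis gh : forall F : R -> \bar R, measurable_fun setT F ->
  (forall x, 0 <= F x) -> (forall u, Z u -> F u = 0) ->
  \int[mu]_(x in A) (F (g x) * (h x)%:E) = \int[mu]_x F x.

Variable Phi : R -> R.
Hypotheses (mPhi : measurable_fun setT Phi) (ZPhi : forall u, Z u -> Phi u = 0%R).

Let mE : measurable_fun setT (EFin \o Phi).
Proof. exact/measurable_EFinP. Qed.

Lemma integral_transfer :
  \int[mu]_(x in A) (Phi (g x) * h x)%:E = \int[mu]_u (Phi u)%:E.
Proof.
rewrite integralE [RHS]integralE; congr (_ - _).
- rewrite -(@gh (EFin \o Phi)^\+)//.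
  + apply: eq_integral => x _; have := h0 x.
    rewrite /= !funeposE /= => hx.
    by rewrite muleC maxe_pMr// mule0 -EFinM mulrC.
  + exact: measurable_funepos.
  + by move=> u /ZPhi Pu; rewrite funeposE /= Pu maxxx.
- rewrite -(@gh (EFin \o Phi)^\-)//.
  + apply: eq_integral => x _; have := h0 x.
    rewrite /= !funenegE /= => hx.
    by rewrite muleC maxe_pMr// mule0 -EFinM mulrN mulrC.
  + exact: measurable_funeneg.
  + by move=> u /ZPhi Pu; rewrite funenegE /= Pu oppr0 maxxx.
Qed.

Lemma integrable_transfer : mu.-integrable A (fun x => (Phi (g x) * h x)%:E) ->
  mu.-integrable setT (EFin \o Phi).
Proof.
move=> /integrableP[_ lty]; apply/integrableP; split => //.
rewrite -(@gh (fun u => `|(Phi u)%:E|))//.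
- apply: le_lt_trans lty; rewrite le_eqVlt; apply/orP; left; apply/eqP.
  apply: eq_integral => x _; have := h0 x => hx.
  by rewrite EFinM abseM (gee0_abs (x := (h x)%:E)).
- exact: measurableT_comp.
- by move=> u /ZPhi ->; rewrite abse0.
Qed.

End signed_transfer.

Section oriented.
Context (R : realType).
Notation mu := (@lebesgue_measure R).

(** Integrating against [chi A B] is integrating from [A] to [B], whatever the
    order of [A] and [B]; Chasles' relation is then a telescoping sum. *)
Definition chi (A B u : R) : R := (A < u)%R%:R - (B < u)%R%:R.

Lemma chiD A B C u : chi A C u = chi A B u + chi B C u.
Proof. by rewrite /chi; ring. Qed.

Lemma chi_rev A B u : u != A -> u != B ->
  chi A B u = (u < B)%R%:R - (u < A)%R%:R.
Proof.
by rewrite /chi; case: (ltgtP u A) => // _ _; case: (ltgtP u B) => // _ _;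
  rewrite /= ?subrr ?subr0 ?sub0r.
Qed.

Lemma measurable_chi A B : measurable_fun setT (chi A B).
Proof.
have mI (a : R) : measurable_fun setT (fun u : R => (a < u)%R%:R : R).
  rewrite (_ : (fun u : R => _) = \1_(`]a, +oo[%classic)); first exact: measurable_indic.
  by apply/funext => u; rewrite indicE mem_setE in_itv/= andbT.
exact: measurable_funB.
Qed.

Variables (e rho : R).
Hypotheses (e1 : e = 1 \/ e = -1) (rho0 : rho != 0).
Local Notation G := (spow e rho).
Local Notation D := (spow (- e) (rho - 1)).

Let norme : `|e| = 1.
Proof. by case: e1 => ->; rewrite ?normrN normr1. Qed.

Lemma ge0_integral_spow_gt0T (F : R -> \bar R) : measurable_fun setT F ->
  (forall x, 0 <= F x)%E -> (forall u, u < 0 -> F u = 0%E) ->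
  (\int[mu]_(x in `]0%R, +oo[) (F (G x) * (`|rho * D x|)%:E) = \int[mu]_x F x)%E.
Proof.
move=> mF F0 Fz; rewrite ge0_integral_spow_gt0// [RHS]ge0_integral_split0//.
have L0 : (\int[mu]_(x in `]-oo, 0%R[) F x = 0)%E.
  by apply: integral0_eq => x; rewrite /= in_itv/= => /Fz.
by rewrite L0 add0e.
Qed.

Lemma ge0_integral_spow_lt0T (F : R -> \bar R) : measurable_fun setT F ->
  (forall x, 0 <= F x)%E -> (forall u, e * u < 0 -> F u = 0%E) ->
  (\int[mu]_(x in `]-oo, 0%R[) (F (G x) * (`|rho * D x|)%:E) = \int[mu]_x F x)%E.
Proof.
move=> mF F0 Fz; rewrite ge0_integral_spow_lt0//.
have e0 : e != 0 by rewrite -normr_eq0 norme oner_eq0.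
have mFe : measurable_fun setT (fun x : R => F (e * x)).
  by apply: measurableT_comp => //; exact: measurable_funM.
rewrite -[RHS](@ge0_integral_affine _ e 0)//.
transitivity (\int[mu]_x F (e * x)%R)%E; last first.
  have K (x : R) : F (e * x) = (F (e * x + 0)%R * `|e|%R%:E)%E.
    by rewrite norme addr0 mule1.
  by apply: eq_integral => x _; exact: K.
rewrite [RHS]ge0_integral_split0//.
have L0 : (\int[mu]_(x in `]-oo, 0%R[) F (e * x)%R = 0)%E.
  apply: integral0_eq => x; rewrite /= in_itv/= => x0; apply: Fz; rewrite mulrA.
  by case: e1 => ->; rewrite ?mulrNN ?mulr1 mul1r.
by rewrite L0 add0e.
Qed.

(** On the positive half-line [rho D] has the sign of [rho], and [G] preserves or
    reverses the order according to that sign: both orientations agree. *)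
Lemma chi_spow_gt0 s t x : 0 <= s -> s < t -> (s = 0 -> 0 < rho) ->
  0 < x -> x != s -> x != t ->
  \1_(`]s, t[%classic) x * (rho * D x) = chi (G s) (G t) (G x) * `|rho * D x|.
Proof.
move=> s0 st srho x0 xs xt.
have t0 : 0 < t by exact: le_lt_trans st.
have Dx : 0 < D x by rewrite gt0_spow// powR_gt0.
rewrite indicE mem_setE in_itv/= normrM (gtr0_norm Dx) /chi.
rewrite mulrA [RHS]mulrA; congr (_ * _).
have Gs : G s = s `^ rho.
  move: s0; rewrite le_eqVlt => /predU1P[<-|s0]; last by rewrite gt0_spow.
  by rewrite spow0// powR0.
rewrite Gs !gt0_spow//.
have [rp|rn|/eqP] := ltgtP 0 rho; last by rewrite eq_sym (negbTE rho0).
- rewrite gtr0_norm// !ltr_powRp ?(ltW x0) ?(ltW t0)//.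
  case: (ltgtP x s) xs => // xs _; case: (ltgtP x t) xt => //= xt _;
    rewrite ?mul0r ?subrr ?mul0r ?subr0 ?mul1r//.
  by exfalso; lra.
- have sp : 0 < s.
    move: s0; rewrite le_eqVlt => /predU1P[/esym/srho|//].
    by move=> /lt_trans/(_ rn); rewrite ltxx.
  rewrite ltr0_norm// !ltr_powRn//.
  case: (ltgtP x s) xs => // xs _; case: (ltgtP x t) xt => //= xt _;
    rewrite ?mul0r ?subrr ?mul0r ?sub0r ?mul1r ?mulrNN ?mul1r//.
  by exfalso; lra.
Qed.

Lemma powR_inj_ge0 (a b : R) : 0 <= a -> 0 <= b -> a `^ rho = b `^ rho -> a = b.
Proof.
move=> a0 b0; have [rp|rn|/eqP] := ltgtP 0 rho; last by rewrite eq_sym (negbTE rho0).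
  by move/(powR_injective rp); apply; rewrite nnegrE.
rewrite -(opprK rho) !(powRN _ (- rho)) => /invr_inj.
by move/(@powR_injective _ (- rho)); rewrite oppr_gt0 => /(_ rn); apply; rewrite nnegrE.
Qed.

Lemma spowN_le0 x : x <= 0 -> G x = e * G (- x).
Proof.
rewrite le_eqVlt => /predU1P[->|x0]; first by rewrite oppr0 spow0// mulr0.
by rewrite lt0_spow// gt0_spow ?oppr_gt0.
Qed.

Lemma spow_neq_le0 x y : x <= 0 -> y <= 0 -> x != y -> G x != G y.
Proof.
move=> x0 y0; apply: contra => /eqP /(congr1 Num.norm).
rewrite !norm_spow// => /powR_inj_ge0.
by rewrite !normr_ge0 => /(_ isT isT); rewrite !ler0_norm// => /oppr_inj/eqP.
Qed.

(** Reflection: for [e = 1] the power is even and its Jacobian odd, for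
    [e = -1] it is the other way round; both changes of sign agree with the
    reversal of the interval. *)
Lemma chi_spow_lt0 s t x : t <= 0 -> s < t -> (t = 0 -> 0 < rho) ->
  x < 0 -> x != s -> x != t ->
  \1_(`]s, t[%classic) x * (rho * D x) = chi (G s) (G t) (G x) * `|rho * D x|.
Proof.
move=> t0 st trho x0 xs xt.
have s0 : s <= 0 by rewrite (le_trans _ t0)// ltW.
have Ht : - t = 0 -> 0 < rho by move/eqP; rewrite oppr_eq0 => /eqP.
have := @chi_spow_gt0 (- t) (- s) (- x).
rewrite oppr_ge0 ltrN2 oppr_gt0 !eqr_opp => /(_ t0 st Ht x0 xt xs).
rewrite !indicE !mem_setE !in_itv/= !ltrN2 (andbC (x < t)).
have -> : D (- x) = - e * D x.
  rewrite gt0_spow ?oppr_gt0// lt0_spow// mulrA mulrNN.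
  by case: e1 => ->; rewrite ?mulrNN mulr1 mul1r.
have -> : rho * (- e * D x) = - e * (rho * D x) by rewrite mulrCA.
rewrite (normrM (- e)) normrN norme mul1r.
have := spow_neq_le0 (ltW x0) s0 xs; have := spow_neq_le0 (ltW x0) t0 xt.
rewrite /chi !(spowN_le0 s0) !(spowN_le0 t0) !(spowN_le0 (ltW x0)).
case: e1 => ->; rewrite ?mul1r ?mulN1r ?eqr_opp => xt' xs'.
  by move=> H; apply: oppr_inj; rewrite -mulrN H; ring.
rewrite !opprK !mul1r !ltrN2 => ->; congr (_ * _).
exact: chi_rev.
Qed.



End oriented.

Section oriented_substitution.
Context (R : realType).
Notation mu := (@lebesgue_measure R).
Variables (e rho : R).
Hypotheses (e1 : e = 1 \/ e = -1) (rho0 : rho != 0).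
Local Notation G := (spow e rho).
Local Notation D := (spow (- e) (rho - 1)).

Let norme : `|e| = 1.
Proof. by case: e1 => ->; rewrite ?normrN normr1. Qed.

Definition oint_integrand (F : R -> R) s t x := \1_(`]s, t[%classic) x * (F (G x) * (rho * D x)).

Lemma measurable_oint_integrand F s t : measurable_fun setT F ->
  measurable_fun setT (oint_integrand F s t).
Proof.
move=> mF; apply: measurable_funM; first exact: measurable_indic.
apply: measurable_funM.
  by apply: (measurableT_comp mF); exact: measurable_spow.
by apply: measurable_funM => //; exact: measurable_spow.
Qed.

Definition half_line (s : R) : set R := if 0 <= s then `]0, +oo[%classic else `]-oo, 0[%classic.

Let measurable_half s : measurable (half_line s).
Proof. by rewrite /half_line; case: ifP. Qed.

Section one_sided.
Variables (F : R -> R) (s t : R).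
Hypotheses (mF : measurable_fun setT F) (st : s < t).
Hypothesis side : (0 <= s /\ (s = 0 -> 0 < rho)) \/ (t <= 0 /\ (t = 0 -> 0 < rho)).

Let Phi u := F u * chi (G s) (G t) u.

Let mPhi : measurable_fun setT Phi.
Proof. by apply: measurable_funM => //; exact: measurable_chi. Qed.

(* The sign of [u] that [G] does not take on the half-line of [s] and [t]. *)
Let Z u := if 0 <= s then u < 0 else e * u < 0.

Let ZPhi u : Z u -> Phi u = 0.
Proof.
rewrite /Z /Phi; case: ifP => [s0 u0|s0 u0].
  have p x : 0 <= x -> (G x < u) = false.
    rewrite le_eqVlt => /predU1P[<-|x0]; first by rewrite spow0// ltNge ltW.
    by apply/negbTE; rewrite -leNgt gt0_spow// (le_trans (ltW u0))// powR_ge0.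
  by rewrite /chi !p ?(le_trans s0 (ltW st))// subrr mulr0.
have t0 : t <= 0 by case: side => -[]//; rewrite s0.
have {}s0 : s <= 0 by rewrite (le_trans (ltW st)).
have GE x : x <= 0 -> G x = e * `|x| `^ rho.
  rewrite le_eqVlt => /predU1P[->|x0]; first by rewrite spow0// normr0 powR0// mulr0.
  by rewrite lt0_spow// ltr0_norm.
rewrite /chi !GE//; set y1 := `|s| `^ rho; set y2 := `|t| `^ rho.
have y1p : 0 <= y1 := powR_ge0 _ _; have y2p : 0 <= y2 := powR_ge0 _ _.
suff -> : (e * y1 < u) = (e * y2 < u) by rewrite subrr mulr0.
by case: e1 u0 => ->; rewrite !(mul1r, mulN1r) => u0; apply/idP/idP; lra.
Qed.

Let transfer (K : R -> \bar R) : measurable_fun setT K ->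
  (forall x, 0 <= K x)%E -> (forall u, Z u -> K u = 0%E) ->
  (\int[mu]_(x in half_line s) (K (G x) * (`|rho * D x|)%:E) = \int[mu]_x K x)%E.
Proof.
rewrite /half_line /Z; case: ifP => s0 mK K0 KZ.
- exact: ge0_integral_spow_gt0T.
- exact: ge0_integral_spow_lt0T.
Qed.

(* The endpoints are excluded: there the indicator of the open interval and [chi],
   which is open on one side only, may disagree. *)
Let integrandE : {ae mu, forall x, oint_integrand F s t x =
  \1_(half_line s) x * (Phi (G x) * `|rho * D x|)}.
Proof.
apply: ae_imp2 (ae_neq 0) (ae_imp2 (fun x p q => conj p q) (ae_neq s) (ae_neq t)).
move=> x x0 [xs xt].
have E : \1_(`]s, t[%classic) x * (rho * D x) = chi (G s) (G t) (G x) * `|rho * D x| ->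
    oint_integrand F s t x = Phi (G x) * `|rho * D x|.
  by move=> E; rewrite /oint_integrand mulrCA E mulrA.
have oI : x <= s \/ t <= x -> oint_integrand F s t x = 0.
  move=> xI; rewrite /oint_integrand indicE mem_setE in_itv/=.
  suff -> : (s < x < t) = false by rewrite mul0r.
  by apply/negbTE; rewrite negb_and -!leNgt; case: xI => ->; rewrite ?orbT.
rewrite /half_line; case: ifP => s0.
- have srho : s = 0 -> 0 < rho.
    by case: side => -[] // t0 _ s00; move: st; rewrite s00 ltNge t0.
  rewrite [\1_(_) x]indicE mem_setE in_itv/= andbT; case: ltP => [xp|xn].
    by rewrite mul1r; apply: E; exact: chi_spow_gt0.
  by rewrite mul0r oI//; left; exact: le_trans s0.
- case: side => -[t0 trho]; first by rewrite t0 in s0.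
  rewrite [\1_(_) x]indicE mem_setE in_itv/=; case: ltP => [xn|xp].
    by rewrite mul1r; apply: E; exact: chi_spow_lt0.
  by rewrite mul0r oI//; right; exact: le_trans xp.
Qed.

Let Psi x := Phi (G x) * `|rho * D x|.

Let measPsi : measurable_fun setT (fun x => \1_(half_line s) x * Psi x).
Proof.
apply: measurable_funM; first exact: measurable_indic.
apply: measurable_funM.
  by apply: (measurableT_comp mPhi); exact: measurable_spow.
apply: measurableT_comp => //.
by apply: measurable_funM => //; exact: measurable_spow.
Qed.

Lemma integral_one_sided :
  (\int[mu]_x (oint_integrand F s t x)%:E = \int[mu]_u (F u * chi (G s) (G t) u)%:E)%E.
Proof.
have E : (\int[mu]_x (oint_integrand F s t x)%:E =
    \int[mu]_x (\1_(half_line s) x * Psi x)%:E)%E.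
  apply: ae_eq_integral => //.
  - by apply/measurable_EFinP; exact: measurable_oint_integrand.
  - by apply/measurable_EFinP; exact: measPsi.
  - by apply: ae_imp integrandE => x -> _.
rewrite E -(integral_transfer (fun x => normr_ge0 (rho * D x)) transfer mPhi ZPhi).
rewrite [RHS]integral_mkcond; apply: eq_integral => x _.
have K (y : R) : (\1_(half_line s) y * Psi y)%:E =
   ((fun x => (Phi (G x) * `|rho * D x|)%:E) \_ (half_line s)) y.
  by rewrite patchE indicE; case: ifP; rewrite ?mul1r ?mul0r.
exact: K.
Qed.

Lemma integrable_one_sided : mu.-integrable setT (EFin \o oint_integrand F s t) ->
  mu.-integrable setT (fun u => (F u * chi (G s) (G t) u)%:E).
Proof.
move=> iF.
apply: (integrable_transfer (fun x => normr_ge0 (rho * D x)) transfer mPhi ZPhi).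
apply/(integrable_indic_mul Psi (measurable_half s)).
apply/integrableP; split; first by apply/measurable_EFinP; exact: measPsi.
have /integrableP[_] := iF; apply: le_lt_trans.
apply: ae_ge0_le_integral => //.
- by apply: measurableT_comp => //; apply/measurable_EFinP; exact: measPsi.
- apply: measurableT_comp => //; apply/measurable_EFinP.
  exact: measurable_oint_integrand.
- by apply: ae_imp integrandE => x E _; rewrite /= E.
Qed.

End one_sided.
End oriented_substitution.

Section two_sided.
Context (R : realType).
Notation mu := (@lebesgue_measure R).
Variables (e rho : R).
Hypotheses (e1 : e = 1 \/ e = -1) (rho0 : rho != 0).
Local Notation G := (spow e rho).
Local Notation D := (spow (- e) (rho - 1)).

Let sub_integrable (F : R -> R) s t s' t' : measurable_fun setT F -> s <= s' -> t' <= t ->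
  mu.-integrable setT (EFin \o oint_integrand e rho F s t) ->
  mu.-integrable setT (EFin \o oint_integrand e rho F s' t').
Proof.
move=> mF ss tt; apply: le_integrable => //.
  by apply/measurable_EFinP; exact: measurable_oint_integrand.
move=> x _; rewrite /= lee_fin /oint_integrand !indicE !mem_setE !in_itv/=.
have [/andP[xs xt]|_] := boolP (s' < x < t'); last by rewrite mul0r normr0.
by rewrite (le_lt_trans ss xs) (lt_le_trans xt tt).
Qed.

(** Across the origin the substitution holds on each side, and Chasles' relation
    glues the two parts together, even when the power is not monotone. *)
Lemma oriented_substitution (F : R -> R) s t : measurable_fun setT F ->
  s < t -> s != 0 -> t != 0 -> (s < 0 -> 0 < t -> 0 < rho) ->
  mu.-integrable setT (EFin \o oint_integrand e rho F s t) ->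
  mu.-integrable setT (fun u => (F u * chi (G s) (G t) u)%:E) /\
  Rintegral mu setT (oint_integrand e rho F s t) =
  Rintegral mu setT (fun u => F u * chi (G s) (G t) u).
Proof.
move=> mF st s0 t0 rp iF.
have [sn|sp|/eqP] := ltgtP s 0; last by rewrite (negbTE s0).
- have [tn|tp|/eqP] := ltgtP t 0; last by rewrite (negbTE t0).
  + have side : (0 <= s /\ (s = 0 -> 0 < rho)) \/ (t <= 0 /\ (t = 0 -> 0 < rho)).
      by right; split; [exact: ltW|move=> /eqP; rewrite (negbTE t0)].
    split; first exact: integrable_one_sided.
    by rewrite /Rintegral integral_one_sided.
  + have rho_gt0 := rp sn tp.
    have side1 : (0 <= s /\ (s = 0 -> 0 < rho)) \/ (0 <= 0 :> R /\ (0 = 0 :> R -> 0 < rho)).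
      by right.
    have side2 : (0 <= 0 :> R /\ (0 = 0 :> R -> 0 < rho)) \/ (t <= 0 /\ (t = 0 -> 0 < rho)).
      by left.
    have i1 := sub_integrable mF (lexx s) (ltW tp) iF.
    have i2 := sub_integrable mF (ltW sn) (lexx t) iF.
    have j1 := integrable_one_sided e1 rho0 mF sn side1 i1.
    have j2 := integrable_one_sided e1 rho0 mF tp side2 i2.
    have chiE u : F u * chi (G s) (G t) u =
        F u * chi (G s) (G 0) u + F u * chi (G 0) (G t) u.
      by rewrite (chiD _ (G 0)) mulrDr.
    split.
      rewrite (_ : (fun u => _) = (fun u => (F u * chi (G s) (G 0) u)%:E +
        (F u * chi (G 0) (G t) u)%:E)%E); first exact: integrableD.
      by apply/funext => u; rewrite chiE.
    transitivity (Rintegral mu setT (fun x => oint_integrand e rho F s 0 x +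
        oint_integrand e rho F 0 t x)).
      apply: Rintegral_ae_eq; first exact: measurable_oint_integrand.
        by apply: measurable_funD; exact: measurable_oint_integrand.
      apply: ae_imp (ae_neq 0) => x x0.
      rewrite /oint_integrand !indicE !mem_setE !in_itv/= -mulrDl; congr (_ * _).
      case: (ltgtP x 0) x0 => // xs _; rewrite ?andbT ?andbF ?addr0 ?add0r.
        by rewrite (lt_trans xs tp) andbT.
      by rewrite (lt_trans sn xs).
    rewrite RintegralD//.
    transitivity (Rintegral mu setT (fun u => F u * chi (G s) (G 0) u +
        F u * chi (G 0) (G t) u)); last first.
      by apply: eq_Rintegral => u _; rewrite chiE.
    rewrite RintegralD//.
    by congr (_ + _); rewrite /Rintegral integral_one_sided.
- have side : (0 <= s /\ (s = 0 -> 0 < rho)) \/ (t <= 0 /\ (t = 0 -> 0 < rho)).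
    by left; split; [exact: ltW|move=> /eqP; rewrite (negbTE s0)].
  split; first exact: integrable_one_sided.
  by rewrite /Rintegral integral_one_sided.
Qed.

Lemma cintegral_oriented_substitution (F : R -> R[i]) s t : cmeasurable F ->
  s < t -> s != 0 -> t != 0 -> (s < 0 -> 0 < t -> 0 < rho) ->
  cintegrable setT (fun x => (\1_(`]s, t[%classic) x)%:C * (F (G x) * (rho * D x)%:C)) ->
  cintegral setT (fun x => (\1_(`]s, t[%classic) x)%:C * (F (G x) * (rho * D x)%:C)) =
  cintegral setT (fun u => F u * (chi (G s) (G t) u)%:C).
Proof.
move=> [mr mi] st s0 t0 rp [].
have Re_ z (r : R) : complex.Re (z * r%:C) = complex.Re z * r.
  by rewrite mulrC ReZ mulrC.
have Im_ z (r : R) : complex.Im (z * r%:C) = complex.Im z * r.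
  by rewrite mulrC ImZ mulrC.
have Er : (fun x => complex.Re ((\1_(`]s, t[%classic) x)%:C * (F (G x) * (rho * D x)%:C)))
    = oint_integrand e rho (fun u => complex.Re (F u)) s t.
  by apply/funext => x; rewrite ReZ Re_.
have Ei : (fun x => complex.Im ((\1_(`]s, t[%classic) x)%:C * (F (G x) * (rho * D x)%:C)))
    = oint_integrand e rho (fun u => complex.Im (F u)) s t.
  by apply/funext => x; rewrite ImZ Im_.
have -> : (fun x => (complex.Re ((\1_(`]s, t[%classic) x)%:C * (F (G x) * (rho * D x)%:C)))%:E)
    = EFin \o oint_integrand e rho (fun u => complex.Re (F u)) s t by rewrite -Er.
have -> : (fun x => (complex.Im ((\1_(`]s, t[%classic) x)%:C * (F (G x) * (rho * D x)%:C)))%:E)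
    = EFin \o oint_integrand e rho (fun u => complex.Im (F u)) s t by rewrite -Ei.
move=> /(oriented_substitution mr st s0 t0 rp)[_ Hr].
move=> /(oriented_substitution mi st s0 t0 rp)[_ Hi].
rewrite /cintegral Er Ei Hr Hi; congr (_ +i* _); apply: eq_Rintegral => u _.
- by rewrite Re_.
- by rewrite Im_.
Qed.

End two_sided.

Lemma cmeasurableZ (R : realType) c (f : R -> R[i]) : cmeasurable f ->
  cmeasurable (fun x => c * f x).
Proof. by apply: cmeasurableM; split. Qed.

(** * Euler's Beta integral with complex phases *)

Section oriented_beta.
Context (R : realType).
Notation mu := (@lebesgue_measure R).
Variables (a b : R).
Hypotheses (a0 : 0 < a) (b0 : 0 < b).

Definition Beta : R := Gamma a * Gamma b / Gamma (a + b).

(** The unit complex number [exp (i p pi)]. *)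
Definition phase (p : R) : R[i] := cos (p * pi) +i* sin (p * pi).

Lemma cpow_gt0 (x g : R) : 0 < x -> cpow x (g - 1) = (ppow g x)%:C.
Proof. by move=> x0; rewrite /cpow /ppow x0 gtr0_norm// ltW// mulr1. Qed.

Lemma cpow_lt0 (x g : R) : x < 0 -> cpow x (g - 1) = (ppow g (- x))%:C * phase (g - 1).
Proof. by move=> x0; rewrite /cpow /ppow oppr_gt0 x0 leNgt x0/= ltr0_norm. Qed.

Lemma phaseD p q : phase p * phase q = phase (p + q).
Proof.
by apply: complex_eqP; rewrite ?ReM ?ImM/= mulrDl ?cosD ?sinD//; ring.
Qed.

Lemma phaseD1 p : phase (p + 1) = - phase p.
Proof. by apply: complex_eqP; rewrite /= mulrDl mul1r ?cosDpi ?sinDpi. Qed.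

Lemma cintegral_real (f : R -> R) : cintegral setT (fun x => (f x)%:C) = (Rintegral mu setT f)%:C.
Proof.
by apply: complex_eqP; rewrite /cintegral//= /Rintegral integral0.
Qed.

Lemma Rintegral_ppow_conv (T S : R) :
  Rintegral mu setT (fun u : R => ppow a (T - u) * ppow b (u - S)) = Beta * ppow (a + b) (T - S).
Proof. by rewrite /Rintegral integral_ppow_conv eBetaE// -EFinM. Qed.

Lemma measurable_ppow_convR (T S : R) :
  measurable_fun setT (fun u : R => ppow a (T - u) * ppow b (u - S)).
Proof. by have /measurable_EFinP := measurable_ppow_conv a b T S. Qed.

Lemma integral_ppow_conv_opp (T S : R) :
  (\int[mu]_u (ppow a (u - T) * ppow b (S - u))%:E = (Beta * ppow (a + b) (S - T))%:E)%E.
Proof.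
have m : measurable_fun setT (fun u : R => (ppow a (u - T) * ppow b (S - u))%:E).
  apply/measurable_EFinP; apply: measurable_funM.
    by apply: (measurableT_comp (@measurable_ppow R a)); exact: measurable_funB.
  by apply: (measurableT_comp (@measurable_ppow R b)); exact: measurable_funB.
rewrite -(@ge0_integral_affine _ (-1) 0)//; last first.
  by move=> u; rewrite lee_fin mulr_ge0// ppow_ge0.
have -> : S - T = - T - - S by ring.
rewrite EFinM -eBetaE// -integral_ppow_conv; apply: eq_integral => u _.
have K (v : R) : ((ppow a (-1 * v + 0 - T) * ppow b (S - (-1 * v + 0)))%:E * `|-1 : R|%:E
    = (ppow a (- T - v) * ppow b (v - - S))%:E)%E.
  rewrite normrN1 mule1 addr0 mulN1r opprK.
  by rewrite opprK (addrC (- v) (- T)) (addrC S).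
exact: K.
Qed.

Lemma Beta_ge0 : 0 <= Beta.
Proof. by rewrite /Beta divr_ge0 ?mulr_ge0 ?ltW ?Gamma_gt0// addr_gt0. Qed.

(** Euler's integral of the first kind between two points in either order: from
    the larger to the smaller one, the reversal of the orientation accounts for
    the missing factor [-1 = exp (i pi)] in the phase. *)
Lemma oriented_beta (T S : R) : T != S ->
  cintegral setT (fun u : R => cpow (T - u) (a - 1) * cpow (u - S) (b - 1) * (chi S T u)%:C)
  = Beta%:C * cpow (T - S) (a + b - 1).
Proof.
have mL : cmeasurable (fun u : R => cpow (T - u) (a - 1) * cpow (u - S) (b - 1) * (chi S T u)%:C).
  apply: cmeasurableM; first apply: cmeasurableM.
  - by apply: cmeasurable_cpow; exact: measurable_funB.
  - by apply: cmeasurable_cpow; exact: measurable_funB.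
  - by apply: cmeasurable_real; exact: measurable_chi.
case: (ltgtP S T) => // [ST|TS] _.
- rewrite cpow_gt0 ?subr_gt0// -rmorphM/= -Rintegral_ppow_conv -cintegral_real.
  apply: cintegral_ae_eq => //.
    by apply: cmeasurable_real; exact: measurable_ppow_convR.
  apply: ae_imp2 (ae_neq S) (ae_neq T) => u uS uT; rewrite /chi.
  case: (ltgtP u S) uS => // [uS|Su] _.
    rewrite ltNge (ltW (lt_trans uS ST)) /= subrr mulr0.
    by rewrite [ppow b _]/ppow subr_gt0 ltNge (ltW uS)/= mulr0.
  case: (ltgtP u T) uT => // [uT|Tu] _.
    by rewrite subr0 mulr1 !cpow_gt0 ?subr_gt0// -rmorphM.
  by rewrite subrr mulr0 [ppow a _]/ppow subr_gt0 ltNge (ltW Tu)/= mul0r.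
- rewrite cpow_lt0 ?subr_lt0// opprB.
  have mr : measurable_fun setT (fun u : R => ppow a (u - T) * ppow b (S - u)).
    apply: measurable_funM.
      by apply: (measurableT_comp (@measurable_ppow R a)); exact: measurable_funB.
    by apply: (measurableT_comp (@measurable_ppow R b)); exact: measurable_funB.
  have ir : cintegrable setT (fun u : R => (ppow a (u - T) * ppow b (S - u))%:C).
    split; last exact: integrable0.
    apply/integrableP; split; first exact/measurable_EFinP.
    under eq_integral do rewrite gee0_abs ?lee_fin ?mulr_ge0 ?ppow_ge0//.
    by rewrite integral_ppow_conv_opp ltry.
  have -> : phase (a + b - 1) = - (phase (a - 1) * phase (b - 1)).
    by rewrite phaseD -phaseD1; congr phase; ring.
  have RE : Rintegral mu setT (fun u : R => ppow a (u - T) * ppow b (S - u))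
      = Beta * ppow (a + b) (S - T).
    by rewrite /Rintegral integral_ppow_conv_opp.
  rewrite mulrA -rmorphM/= mulrC -RE.
  rewrite -cintegral_real -cintegralZ//.
  apply: cintegral_ae_eq => //.
    by apply: (cmeasurableZ _ (cmeasurable_real mr)).
  apply: ae_imp2 (ae_neq S) (ae_neq T) => u uS uT; rewrite /chi.
  case: (ltgtP u T) uT => // [uT|Tu] _.
    rewrite ltNge (ltW (lt_trans uT TS)) /= subrr mulr0.
    by rewrite [ppow a _]/ppow subr_gt0 ltNge (ltW uT)/= mul0r mulr0.
  case: (ltgtP u S) uS => // [uS|Su] _.
    rewrite sub0r !cpow_lt0 ?subr_lt0// !opprB rmorphM/=.
    have -> : (-1)%:C = -1 :> R[i] by exact: rmorphN1.
    ring.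
  by rewrite subrr mulr0 [ppow b _]/ppow subr_gt0 ltNge (ltW Su)/= !mulr0.
Qed.

End oriented_beta.

(** * Composition of fractional integrals with integrable density *)

Section fractional_integral.
Context (R : realType).
Notation mu := (@lebesgue_measure R).
Variables (a b e rho L : R).
Hypotheses (e1 : e = 1 \/ e = -1) (rho0 : rho != 0).
Local Notation G := (spow e rho).
Local Notation D := (spow (- e) (rho - 1)).
Hypothesis GL : forall x, a <= x <= b -> `|G x| <= L.
Hypothesis rho_gt0 : a < 0 -> 0 < b -> 0 < rho.
Variable w : R -> R[i].
Hypothesis iw : cintegrable setT w.

Let norme : `|e| = 1.
Proof. by case: e1 => ->; rewrite ?normrN normr1. Qed.

Let mw : cmeasurable w.
Proof. by case: iw => wr wi; split; apply/measurable_EFinP; [exact: measurable_int wr|exact: measurable_int wi]. Qed.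

Let mG := @measurable_spow R e rho.

Let mD : measurable_fun setT (fun x => rho * D x).
Proof. by apply: measurable_funM => //; exact: measurable_spow. Qed.

(** Half-open intervals make the indicators of [a <= s < x] and [a <= x < t]
    combine exactly into the open interval [s < x < t]. *)
Definition ind (s t : R) : R := ((a <= s) && (s < t))%:R.

Lemma measurable_ind d (T : measurableType d) (p q : T -> R) :
  measurable_fun setT p -> measurable_fun setT q ->
  measurable_fun setT (fun z => ind (p z) (q z)).
Proof.
move=> mp mq; rewrite /ind.
have -> : (fun z => ((a <= p z) && (p z < q z))%:R : R) =
    (fun z => if (a <= p z) && (p z < q z) then 1 else 0 : R).
  by apply/funext => z; case: ifP.
apply: measurable_fun_ifT => //; apply: measurable_and.
  exact: measurable_fun_ler.
exact: measurable_fun_ltr.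
Qed.

Definition fker (g : R) (z : R * R) : R[i] :=
  (ind z.2 z.1)%:C * (cpow (G z.1 - G z.2) (g - 1) * w z.2).

(** The fractional integral of order [g] in the variable [G], of the density [w],
    without its normalization. *)
Definition fint (g t : R) : R[i] := cintegral setT (fun s => fker g (t, s)).

Lemma cmeasurable_fker g : cmeasurable (fker g).
Proof.
have m1 := @measurable_fst _ _ R R; have m2 := @measurable_snd _ _ R R.
apply: cmeasurableM.
  by apply: cmeasurable_real; exact: measurable_ind.
apply: cmeasurableM.
  apply: cmeasurable_cpow; apply: measurable_funB.
  - exact: (measurableT_comp mG m1).
  - exact: (measurableT_comp mG m2).
exact: (cmeasurable_comp mw m2).
Qed.

Lemma cmeasurable_fint g : cmeasurable (fint g).
Proof. exact: (cmeasurable_cintegral_param (cmeasurable_fker g)). Qed.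

Variables (alpha beta : R).
Hypotheses (alpha0 : 0 < alpha) (beta0 : 0 < beta).

Section fixed_time.
Variable t : R.
Hypotheses (tab : a <= t <= b) (t0 : t != 0).

Let J : set R := `[a, b]%classic.
Let d x : R := `|rho * D x|.
Let nw x : \bar R := (norm1 (w x))%:E.

Hypothesis fin : (\int[mu]_s ((pker e rho J alpha (t, s))%:E *
   kop (pker e rho J beta) d nw s) < +oo)%E.

Let outer (x : R) : R[i] := (ind x t)%:C * (cpow (G t - G x) (alpha - 1) * (rho * D x)%:C).
Let f (z : R * R) : R[i] := outer z.1 * fker beta z.

Let bound (z : R * R) : \bar R := 4%:E *
  ((pker e rho J alpha (t, z.1))%:E * ((d z.1)%:E * ((pker e rho J beta z)%:E * nw z.2)))%E.

Let m_outer : cmeasurable outer.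
Proof.
apply: cmeasurableM.
  by apply: cmeasurable_real; exact: measurable_ind.
apply: cmeasurableM; last exact: cmeasurable_real.
by apply: cmeasurable_cpow; exact: measurable_funB.
Qed.

Let mf : cmeasurable f.
Proof.
apply: cmeasurableM; last exact: cmeasurable_fker.
exact: (cmeasurable_comp m_outer (@measurable_fst _ _ R R)).
Qed.

Let mJ : measurable J. Proof. exact: measurable_itv. Qed.

Let mb : measurable_fun setT bound.
Proof.
have m1 := @measurable_fst _ _ R R; have m2 := @measurable_snd _ _ R R.
apply: emeasurable_funM => //; apply: emeasurable_funM.
  apply/measurable_EFinP.
  exact: (measurableT_comp (measurable_fun_pair2 t (measurable_pker e rho mJ alpha)) m1).
apply: emeasurable_funM.
  apply/measurable_EFinP; apply: (measurableT_comp _ m1).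
  exact: (measurableT_comp (@normr_measurable R setT) mD).
apply: emeasurable_funM.
  by apply/measurable_EFinP; exact: measurable_pker.
apply/measurable_EFinP; exact: (measurableT_comp (measurable_norm1 mw) m2).
Qed.

Let fb z : ((norm1 (f z))%:E <= bound z)%E.
Proof.
case: z => x s; rewrite /f /outer /fker /bound /d /nw /= -!EFinM lee_fin /pker /=.
have [ax|] := boolP ((a <= x) && (x < t)); last first.
  move=> /negbTE nx; rewrite {1}/ind nx !mul0r /norm1 /= normr0 addr0.
  by rewrite !mulr_ge0 ?powR_ge0 ?addr_ge0.
have [as_|] := boolP ((a <= s) && (s < x)); last first.
  move=> /negbTE nx; rewrite {2}/ind nx !mul0r mulr0 /norm1 /= normr0 addr0.
  by rewrite !mulr_ge0 ?powR_ge0 ?addr_ge0.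
have [/andP[at_ tb] /andP[ax1 xt] /andP[as1 sx]] := And3 tab ax as_.
have tJ : t \in J by rewrite inE /J/= in_itv/= at_.
have xJ : x \in J by rewrite inE /J/= in_itv/= ax1 (le_trans (ltW xt)).
have sJ : s \in J by rewrite inE /J/= in_itv/= as1 (le_trans (ltW (lt_trans sx xt))).
rewrite /ind ax as_ !indicE tJ xJ sJ /= (_ : (1%:R)%:C = 1 :> R[i])// !mul1r.
have P0 : 0 <= `|G t - G x| `^ (alpha - 1) := powR_ge0 _ _.
have Q0 : 0 <= `|G x - G s| `^ (beta - 1) := powR_ge0 _ _.
have le1 : norm1 (cpow (G t - G x) (alpha - 1) * (rho * D x)%:C) <=
    2 * `|G t - G x| `^ (alpha - 1) * `|rho * D x|.
  by rewrite (le_trans (norm1M _ _))// norm1_real ler_wpM2r// norm1_cpow.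
have le2 : norm1 (cpow (G x - G s) (beta - 1) * w s) <=
    2 * `|G x - G s| `^ (beta - 1) * norm1 (w s).
  by rewrite (le_trans (norm1M _ _))// ler_wpM2r ?norm1_ge0// norm1_cpow.
rewrite (le_trans (norm1M _ _))// (le_trans (ler_pM _ _ le1 le2)) ?norm1_ge0//.
by rewrite le_eqVlt; apply/orP; left; apply/eqP; ring.
Qed.

Let b_fin : (\int[mu]_x \int[mu]_s bound (x, s) < +oo)%E.
Proof.
have nw0 x : (0 <= nw x)%E by rewrite lee_fin norm1_ge0.
have mnw : measurable_fun setT nw by apply/measurable_EFinP; exact: measurable_norm1.
have md : measurable_fun setT d.
  exact: (measurableT_comp (@normr_measurable R setT) mD).
have p0 g z := @pker_ge0 R e rho J g z.
have k0 := kop_ge0 (p0 beta) (fun x => normr_ge0 (rho * D x)) nw0.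
have E : (\int[mu]_x \int[mu]_s bound (x, s) = 4%:E * \int[mu]_s
    ((pker e rho J alpha (t, s))%:E * kop (pker e rho J beta) d nw s))%E.
  rewrite -ge0_integralZl//=; last 2 first.
  - apply: emeasurable_funM.
      apply/measurable_EFinP.
      exact: (measurable_fun_pair2 t (measurable_pker e rho mJ alpha)).
    exact: (@measurable_kop R (pker e rho J beta) d (measurable_pker e rho mJ beta) md (p0 beta) nw mnw nw0).
  - by move=> x _; rewrite mule_ge0// ?lee_fin.
  have mk x : measurable_fun setT (fun s => ((pker e rho J beta (x, s))%:E * nw s)%E).
    exact: (measurable_fun_pair2 x (measurable_kop_fun (measurable_pker e rho mJ beta) mnw)).
  have kn0 x s : (0 <= (pker e rho J beta (x, s))%:E * nw s)%E.
    by apply: mule_ge0; [rewrite lee_fin p0|exact: nw0].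
  have dk0 x s : (0 <= (d x)%:E * ((pker e rho J beta (x, s))%:E * nw s))%E.
    by apply: mule_ge0; [exact: normr_ge0|exact: kn0].
  have mdk x : measurable_fun setT
      (fun s => (d x)%:E * ((pker e rho J beta (x, s))%:E * nw s))%E.
    by apply: emeasurable_funM; [exact: measurable_cst|exact: mk].
  have K x : (\int[mu]_s bound (x, s) =
      4%:E * ((pker e rho J alpha (t, x))%:E * kop (pker e rho J beta) d nw x))%E.
    rewrite /bound /kop /= ge0_integralZl//=; last 2 first.
    - by apply: emeasurable_funM; [exact: measurable_cst|exact: mdk].
    - by move=> s _; apply: mule_ge0; [rewrite lee_fin p0|exact: dk0].
    congr (_ * _)%E; rewrite ge0_integralZl//=; last 2 first.
    - exact: mdk.
    - by rewrite lee_fin p0.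
    by congr (_ * _)%E; rewrite ge0_integralZl//=; [exact: mk|exact: normr_ge0].
  by apply: eq_integral => x _; exact: K.
rewrite E; move: fin; set I := integral _ _ _ => Ify.
have : (0 <= I)%E.
  by apply: integral_ge0 => x _; rewrite mule_ge0// lee_fin.
by case: I Ify => // r _ _; rewrite -EFinM ltry.
Qed.

Lemma iterated_fintE :
  cintegral setT (fun x => cintegral setT (fun s => f (x, s))) =
  cintegral setT (fun x => outer x * fint beta x).
Proof.
apply: cintegral_ae_eq.
- exact: cmeasurable_cintegral_param.
- by apply: cmeasurableM => //; exact: cmeasurable_fint.
apply: ae_imp (ae_cintegrable1 mf mb fb b_fin) => x ix.
exact: (@cintegralZ_integrable _ (outer x) (fun s => fker beta (x, s)) ix).
Qed.

(** For fixed [s] the integrand is a function of [G x] times the Jacobian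
    [rho D x], so its integral from [s] to [t] depends only on the end values
    [G s] and [G t] and is Euler's. *)
Lemma swapped_fintE :
  cintegral setT (fun s => cintegral setT (fun x => f (x, s))) =
  (Beta alpha beta)%:C * fint (alpha + beta) t.
Proof.
rewrite /fint -cintegralZ_ge0; last 2 first.
- exact: Beta_ge0.
- have [kr ki] := cmeasurable_fker (alpha + beta).
  by split; [exact: (measurable_fun_pair2 t kr)|exact: (measurable_fun_pair2 t ki)].
apply: cintegral_ae_eq.
- have msw : measurable_fun setT (fun z : R * R => (z.2, z.1)).
    by apply: measurable_fun_pair; [exact: measurable_snd|exact: measurable_fst].
  exact: (cmeasurable_cintegral_param (cmeasurable_comp mf msw)).
- apply: cmeasurableZ; have [kr ki] := cmeasurable_fker (alpha + beta).
  by split; [exact: (measurable_fun_pair2 t kr)|exact: (measurable_fun_pair2 t ki)].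
apply: ae_imp2 (ae_cintegrable2 mf mb fb b_fin)
  (ae_imp2 (fun x p q => conj p q) (ae_neq 0) (ae_imp2 (fun x p q => conj p q) (ae_neq t) (ae_neq (- t)))).
move=> s is_ [s0 [st sNt]]; rewrite /fker /=.
have [/andP[as_ slt]|nst] := boolP ((a <= s) && (s < t)); last first.
  rewrite {1}/ind (negbTE nst) mul0r mulr0 cintegral0// => x _.
  rewrite /f /outer /fker /= /ind.
  have [/andP[ax xt]|_] := boolP ((a <= x) && (x < t)); last by rewrite !mul0r.
  have [/andP[as_ sx]|_] := boolP ((a <= s) && (s < x)); last by rewrite mul0r mulr0.
  by move: nst; rewrite as_ (lt_trans sx xt).
have [ws0|ws0] := eqVneq (w s) 0.
  rewrite ws0 !mulr0 cintegral0// => x _.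
  by rewrite /f /fker /= ws0 !mulr0.
pose F u := cpow (G t - u) (alpha - 1) * cpow (u - G s) (beta - 1).
pose q x := (\1_(`]s, t[%classic) x)%:C * (F (G x) * (rho * D x)%:C).
have fq x : f (x, s) = w s * q x.
  rewrite /f /outer /fker /q /F /= indicE mem_setE in_itv/= /ind as_/=.
  have [sx|xs] := ltP s x; last by rewrite mul0r mulr0 mul0r mulr0.
  rewrite (le_trans as_ (ltW sx))/= mul1r; ring.
have -> : cintegral setT (fun x => f (x, s)) = w s * cintegral setT q.
  under [LHS]eq_cintegral do rewrite fq.
  by apply: cintegralZ_integrable; move: is_; under eq_fun do rewrite fq.
have iq : cintegrable setT q.
  move: is_; under eq_fun do rewrite fq; move/(cintegrableZ (w s)^-1).
  by under eq_fun do rewrite mulKf//.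
have mF : cmeasurable F.
  by apply: cmeasurableM; apply: cmeasurable_cpow; exact: measurable_funB.
rewrite (cintegral_oriented_substitution e1 rho0 mF slt s0 t0 _ iq); last first.
  move=> sn tp; apply: rho_gt0; first exact: le_lt_trans sn.
  by case/andP: tab => _; exact: lt_le_trans.
(* [G] is injective up to sign. *)
have GtGs : G t != G s.
  apply/eqP => /(congr1 Num.norm); rewrite !norm_spow// => /(powR_inj_ge0 rho0).
  rewrite !normr_ge0 => /(_ isT isT)/eqP; rewrite eqr_norm2.
  by case/orP => /eqP tE; [move: st|move: sNt]; rewrite tE ?opprK eqxx.
rewrite oriented_beta// /ind as_ slt/=.
by rewrite (_ : (1%:R)%:C = 1 :> R[i])// mul1r; ring.
Qed.

Lemma fint_composition :
  cintegral setT (fun x => outer x * fint beta x) =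
  (Beta alpha beta)%:C * fint (alpha + beta) t.
Proof.
rewrite -iterated_fintE -swapped_fintE.
exact: (cintegral_Fubini mf mb fb b_fin).
Qed.

End fixed_time.
(** The domination needed by Fubini holds for almost every [t], by iterating the
    operator bound. *)
Lemma ae_fint_composition : {ae mu, forall t, a <= t <= b ->
  cintegral setT (fun x => (ind x t)%:C *
    (cpow (G t - G x) (alpha - 1) * (rho * D x)%:C) * fint beta x) =
  (Beta alpha beta)%:C * fint (alpha + beta) t}.
Proof.
have mJ : measurable (`[a, b]%classic : set R) by exact: measurable_itv.
have JL x : (`[a, b]%classic : set R) x -> `|G x| <= L.
  by rewrite /= in_itv/=; exact: GL.
have nw0 x : (0 <= (norm1 (w x))%:E)%E by rewrite lee_fin norm1_ge0.
have mnw : measurable_fun setT (fun x => (norm1 (w x))%:E).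
  by apply/measurable_EFinP; exact: measurable_norm1.
have nwy : (\int[mu]_x (norm1 (w x))%:E < +oo)%E.
  have /integrableP[_] := norm1_integrable iw.
  by under eq_integral do rewrite gee0_abs ?nw0//.
pose J : set R := `[a, b]%classic; pose d x := `|rho * D x|.
pose nw x := (norm1 (w x))%:E; pose V := kop (pker e rho J beta) d nw.
have mV : measurable_fun setT V by exact: (measurable_pker_op e rho mJ beta mnw nw0).
have V0 x : (0 <= V x)%E.
  exact: (kop_ge0 (@pker_ge0 R e rho J beta) (fun x => normr_ge0 (rho * D x)) nw0).
have Vy : (\int[mu]_x V x < +oo)%E.
  exact: (pker_op_lt_pinfty norme rho0 mJ JL beta0 mnw nw0 nwy).
have H := ae_pker_lt_pinfty norme rho0 mJ JL alpha0 mV V0 Vy.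
by apply: ae_imp2 (ae_neq 0) H => t t0 tfin tab; exact: fint_composition (tfin t0).
Qed.

End fractional_integral.

(** * Real powers on the interval *)

Section real_powers.
Context (R : realType).
Notation mu := (@lebesgue_measure R).

Lemma lt0_exprz (x : R) (n : int) : x < 0 -> x ^ n = (-1) ^ n * (- x) `^ n%:~R.
Proof.
move=> x0; have nx0 : 0 < - x by rewrite oppr_gt0.
rewrite powR_intmul ?(ltW nx0)// -exprzMl ?unitfE ?oppr_eq0 ?oner_eq0 ?lt_eqF//.
by rewrite mulN1r opprK.
Qed.

Lemma exprzN1_cases (n : int) : (-1 : R) ^ n = 1 \/ (-1 : R) ^ n = -1.
Proof.
case: n => n; rewrite ?NegzE -?exprnP -?exprnN -?exprVn ?invrN1;
  by rewrite -signr_odd; case: odd; [right; rewrite expr1|left; rewrite expr0].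
Qed.

Lemma exprzN1D1 (n : int) : (-1 : R) ^ (n - 1) = - (-1) ^ n.
Proof. by rewrite expfzDr ?oppr_eq0 ?oner_eq0// exprN1 invrN1 mulrN1. Qed.

Lemma exprzN1_1B (n : int) : (-1 : R) ^ (1 - n) = - (-1) ^ n.
Proof.
rewrite -opprB -exprz_inv invrN1; exact: exprzN1D1.
Qed.

Lemma powR_le_bounds (p m M x : R) : 0 < m -> m <= x <= M -> x `^ p <= m `^ p + M `^ p.
Proof.
move=> m0 /andP[mx xM]; have x0 := lt_le_trans m0 mx.
have M0 := lt_le_trans x0 xM.
have [p0|p0] := leP 0 p.
  rewrite -[leLHS]add0r lerD ?powR_ge0// ge0_ler_powR// nnegrE ?ltW//.
rewrite -[leLHS]addr0 lerD ?powR_ge0//.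
by rewrite leNgt ltr_powRn// -leNgt.
Qed.

Variables (a b rho : R).
Hypothesis hpow : forall t, a <= t <= b -> rpow_defined t rho.

(** The sign [e] for which [t^rho] is [spow e rho t] on the interval; at negative
    points [rho] is an integer. *)
Definition parity : R := if a < 0 then (-1) ^ Num.floor rho else 1.

Lemma parity_cases : parity = 1 \/ parity = -1.
Proof. by rewrite /parity; case: ifP => _; [exact: exprzN1_cases|left]. Qed.

Lemma rho_int x : a <= x <= b -> x < 0 -> rho = (Num.floor rho)%:~R.
Proof.
move=> /hpow[xp|[[-> _]|[_ rint]]] xn; last by apply/esym/eqP; rewrite -intrEfloor.
- by move: (lt_trans xp xn); rewrite ltxx.
- by move: xn; rewrite ltxx.
Qed.

Lemma rpowE x : a <= x <= b -> rpow x rho = spow parity rho x.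
Proof.
move=> xab; rewrite /rpow; have [x0|x0] := leP 0 x.
  by rewrite /spow x0 ger0_norm// mulr1.
rewrite lt0_spow// lt0_exprz// -(rho_int xab x0) /parity.
by case/andP: xab => ax _; rewrite (le_lt_trans ax x0).
Qed.

Lemma rpow_subr1E x : a <= x <= b -> rpow x (rho - 1) = spow (- parity) (rho - 1) x.
Proof.
move=> xab; rewrite /rpow; have [x0|x0] := leP 0 x.
  by rewrite /spow x0 ger0_norm// mulr1.
rewrite lt0_spow// lt0_exprz// /parity.
case/andP: (xab) => ax _; rewrite (le_lt_trans ax x0).
have -> : Num.floor (rho - 1) = Num.floor rho - 1.
  by rewrite {1}(rho_int xab x0) -[1 in LHS](_ : 1%:~R = 1)// -intrB intrKfloor.
by rewrite exprzN1D1 intrB -(rho_int xab x0).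
Qed.

Lemma rpow_1subrE x : a <= x <= b -> rpow x (1 - rho) = spow (- parity) (1 - rho) x.
Proof.
move=> xab; rewrite /rpow; have [x0|x0] := leP 0 x.
  by rewrite /spow x0 ger0_norm// mulr1.
rewrite lt0_spow// lt0_exprz// /parity.
case/andP: (xab) => ax _; rewrite (le_lt_trans ax x0).
have -> : Num.floor (1 - rho) = 1 - Num.floor rho.
  by rewrite {1}(rho_int xab x0) -[1 in LHS](_ : 1%:~R = 1)// -intrB intrKfloor.
by rewrite exprzN1_1B intrB -(rho_int xab x0).
Qed.

Lemma rho_gt0_at0 : a <= 0 <= b -> 0 < rho.
Proof. by move=> /hpow; rewrite /rpow_defined !ltxx => -[//|[[]//|[]//]]. Qed.

(** If the interval avoids the origin, [|x|] stays between two positive bounds;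
    otherwise the exponent is nonnegative. *)
Lemma norm_powR_bounded (p : R) : (a <= 0 <= b -> 0 <= p) ->
  exists C : R, forall x, a <= x <= b -> `|x| `^ p <= C.
Proof.
move=> p0; have [ap|an] := ltP 0 a.
  exists (a `^ p + b `^ p) => x /andP[ax xb]; apply: powR_le_bounds => //.
  by rewrite gtr0_norm ?ax// (lt_le_trans ap).
have [bn|bp] := ltP b 0.
  exists ((- b) `^ p + (- a) `^ p) => x /andP[ax xb].
  apply: powR_le_bounds; first by rewrite oppr_gt0.
  by rewrite ler0_norm ?lerN2 ?xb ?ax// (le_trans xb)// ltW.
exists ((`|a| + `|b|) `^ p) => x /andP[ax xb].
rewrite ge0_ler_powR ?nnegrE ?addr_ge0// ?p0 ?an//.
rewrite (ler0_norm an) (ger0_norm bp) ler_norml; apply/andP; split; lra.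
Qed.

End real_powers.

(** * The semigroup law for integrable densities *)

Lemma real_coef_eq (R : realType) (x y z u v : R) (c : R[i]) :
  x * (y * z) = u * v -> x%:C * (y%:C * (z%:C * c)) = u%:C * (v%:C * c).
Proof. by move=> E; rewrite (mulrA y%:C) mulrA -!rmorphM/= E rmorphM mulrA. Qed.

Lemma gamma_coef_eq (F : fieldType) (r x y z c : F) : x != 0 -> y != 0 -> z != 0 ->
  r / x * (c / y * (x * y / z)) = r / z * c.
Proof. by move=> x0 y0 z0; field; rewrite x0 y0 z0. Qed.

Section integrable_case.
Context (R : realType).
Notation mu := (@lebesgue_measure R).
Variables (a b sigma rho alpha beta : R).
Hypotheses (rho0 : rho != 0) (alpha0 : 0 < alpha) (beta0 : 0 < beta).
Hypothesis hpow : forall t, a <= t <= b -> rpow_defined t rho.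
Local Notation e := (parity a rho).
Local Notation G := (spow e rho).
Local Notation D := (spow (- e) (rho - 1)).
Variable psi : R -> R[i].
Hypothesis ipsi : cintegrable `[a, b]
  (fun s => (expR (sigma * rpow s rho) * rpow s (rho - 1))%:C * psi s).

Let w (s : R) : R[i] :=
  (\1_(`[a, b]%classic) s)%:C * ((expR (sigma * rpow s rho) * rpow s (rho - 1))%:C * psi s).

Let iw : cintegrable setT w.
Proof. exact: ((cintegrable_indic _ (measurable_itv _)).1 ipsi). Qed.

Let mw : cmeasurable w.
Proof. by case: iw => wr wi; split; apply/measurable_EFinP; [exact: measurable_int wr|exact: measurable_int wi]. Qed.

Let sub_itv t s : a <= t <= b -> a <= s <= t -> a <= s <= b.
Proof. by case/andP => _ tb /andP[-> st]; rewrite (le_trans st tb). Qed.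

Let cintegral_closed_ind t (f : R -> R[i]) : cmeasurable f ->
  cintegral setT (fun s => (\1_(`[a, t]%classic) s)%:C * f s) =
  cintegral setT (fun s => (ind a s t)%:C * f s).
Proof.
move=> mf; apply: cintegral_ae_eq.
- apply: cmeasurableM => //; apply: cmeasurable_real; exact: measurable_indic.
- apply: cmeasurableM => //; apply: cmeasurable_real; exact: measurable_ind.
apply: ae_imp (ae_neq t) => s st; rewrite indicE mem_setE in_itv/= /ind.
by rewrite [s <= t]le_eqVlt (negbTE st).
Qed.

Let cmeasurable_integrand g t : cmeasurable (fun s => cpow (G t - G s) (g - 1) * w s).
Proof.
apply: cmeasurableM => //; apply: cmeasurable_cpow; apply: measurable_funB => //.
exact: measurable_spow.
Qed.

(** The exponential splits as [exp (- sigma G t) * exp (sigma G s)]: the second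
    factor is part of the density [w], the first one comes out. *)
Lemma subst_integralE g t : a <= t <= b ->
  subst_integral sigma rho a g psi t =
  (rho / Gamma g)%:C * ((expR (- sigma * G t))%:C * fint a e rho w g t).
Proof.
move=> tab; rewrite /subst_integral; congr (_ * _).
rewrite cintegral_indic.
transitivity (cintegral setT (fun s => (expR (- sigma * G t))%:C *
   ((\1_(`[a, t]%classic) s)%:C * (cpow (G t - G s) (g - 1) * w s)))).
  apply: eq_cintegral => s _; rewrite indicE mem_setE in_itv/=.
  have [sat|_] := boolP (a <= s <= t); last by rewrite !mul0r mulr0.
  have sab := sub_itv tab sat.
  rewrite /w indicE mem_setE in_itv/= sab (rpowE hpow tab) (rpowE hpow sab).
  have -> : - sigma * (G t - G s) = - sigma * G t + sigma * G s by ring.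
  by rewrite expRD !rmorphM/=; ring.
rewrite (cintegralZ_ge0 (expR_ge0 _)); last first.
  by apply: cmeasurableM => //; apply: cmeasurable_real; exact: measurable_indic.
by congr (_ * _); rewrite cintegral_closed_ind.
Qed.

Lemma subst_integral_semigroup_integrable :
  {ae mu, forall t, a <= t <= b ->
    subst_integral sigma rho a alpha (subst_integral sigma rho a beta psi) t =
    subst_integral sigma rho a (alpha + beta) psi t}.
Proof.
have [L GL] := @norm_powR_bounded R a b rho (fun z => ltW (rho_gt0_at0 hpow z)).
have e1 := parity_cases a rho.
have norme : `|e| = 1 by case: e1 => ->; rewrite ?normrN normr1.
have GL' x : a <= x <= b -> `|G x| <= L by move=> xab; rewrite norm_spow// GL.
have rp : a < 0 -> 0 < b -> 0 < rho.
  by move=> an bp; apply: (rho_gt0_at0 hpow); rewrite !ltW.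
have := ae_fint_composition e1 rho0 GL' rp iw alpha0 beta0.
apply: ae_imp => t H tab; rewrite (subst_integralE _ tab).
have {H} := H tab; set lhs := cintegral _ _ => H.
have Ga := Gamma_gt0 alpha0; have Gb := Gamma_gt0 beta0.
have Gab := Gamma_gt0 (addr_gt0 alpha0 beta0).
have mD : measurable_fun setT (fun x : R => rho * D x).
  by apply: measurable_funM => //; exact: measurable_spow.
pose f s := cpow (G t - G s) (alpha - 1) * (rho * D s)%:C * fint a e rho w beta s.
have mf : cmeasurable f.
  apply: cmeasurableM; last exact: cmeasurable_fint.
  apply: cmeasurableM; last exact: cmeasurable_real.
  by apply: cmeasurable_cpow; apply: measurable_funB => //; exact: measurable_spow.
transitivity ((rho / Gamma alpha)%:C * ((expR (- sigma * G t) / Gamma beta)%:C * lhs)).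
  rewrite {1}/subst_integral; congr (_ * _); rewrite cintegral_indic.
  transitivity (cintegral setT (fun s => (expR (- sigma * G t) / Gamma beta)%:C *
     ((\1_(`[a, t]%classic) s)%:C * f s))).
    apply: eq_cintegral => s _; rewrite indicE mem_setE in_itv/=.
    have [sat|_] := boolP (a <= s <= t); last by rewrite !mul0r mulr0.
    have sab := sub_itv tab sat.
    rewrite (subst_integralE _ sab) (rpowE hpow tab) (rpowE hpow sab) (rpow_subr1E hpow sab) /f.
    have -> : expR (- sigma * G t) = expR (- sigma * (G t - G s)) * expR (- sigma * G s).
      by rewrite -expRD; congr expR; ring.
    by rewrite !rmorphM/=; ring.
  rewrite (cintegralZ_ge0 (divr_ge0 (expR_ge0 _) (ltW Gb))); last first.
    by apply: cmeasurableM => //; apply: cmeasurable_real; exact: measurable_indic.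
  congr (_ * _); rewrite cintegral_closed_ind//.
  by rewrite /lhs; apply: eq_cintegral => s _; exact: mulrA.
rewrite H; apply: real_coef_eq; rewrite /Beta.
exact: (gamma_coef_eq _ _ (lt0r_neq0 Ga) (lt0r_neq0 Gb) (lt0r_neq0 Gab)).
Qed.

End integrable_case.

(** * Intervals starting at the origin *)

Section nonintegrable.
Context (R : realType).
Notation mu := (@lebesgue_measure R).

(** One of the integrals of the positive and negative parts is infinite, hence so
    is their difference, and its real value is zero by convention. *)
Lemma Rintegral_nonintegrable (f : R -> R) : measurable_fun setT f ->
  ~ mu.-integrable setT (EFin \o f) -> Rintegral mu setT f = 0.
Proof.
move=> mf nf; have mE : measurable_fun setT (EFin \o f) by exact/measurable_EFinP.
rewrite /Rintegral integralE.
have : (\int[mu]_x `|(EFin \o f) x| = +oo)%E.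
  apply/eqP; rewrite eq_le leey leNgt; apply/negP => lty.
  by apply: nf; apply/integrableP.
rewrite (_ : (fun x => `|(EFin \o f) x|)%E =
  (fun x => ((EFin \o f)^\+ x + (EFin \o f)^\- x)%E)); last first.
  by apply/funext => x; rewrite -/((abse \o (EFin \o f)) x) fune_abse.
rewrite ge0_integralD//; last 2 first.
- exact: (measurable_funepos mE).
- exact: (measurable_funeneg mE).
have : (0 <= \int[mu]_x ((EFin \o f)^\+ x))%E by exact: integral_ge0.
have : (0 <= \int[mu]_x ((EFin \o f)^\- x))%E by exact: integral_ge0.
set y := integral _ _ _; set z := integral _ _ _.
by case: y => [y||]//; case: z => [z||].
Qed.

Lemma bounded_mul_integrable (A : set R) (r f : R -> R) (C : R) : measurable A ->
  measurable_fun setT r -> (forall x, A x -> `|r x| <= C) ->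
  mu.-integrable A (EFin \o f) -> mu.-integrable A (fun x => (r x * f x)%:E).
Proof.
move=> mA mr rC fi.
have Ci : mu.-integrable A (fun x => C%:E * (EFin \o f) x)%E by exact: integrableZl.
apply: (@le_integrable _ _ _ mu A mA _ (fun x => C%:E * (EFin \o f) x)%E _ _ Ci).
  apply/measurable_EFinP; apply: measurable_funM; first exact: measurable_funTS.
  by apply/measurable_EFinP; exact: measurable_int fi.
move=> x Ax; rewrite /= lee_fin !normrM ler_wpM2r//.
by rewrite (le_trans (rC x Ax))// ler_norm.
Qed.

End nonintegrable.

Section origin.
Context (R : realType).
Notation mu := (@lebesgue_measure R).
Variables (b sigma rho : R).
Hypothesis rho_gt0 : 0 < rho.

Definition rker (g t s : R) : R :=
  (t `^ rho - s `^ rho) `^ (g - 1) * expR (- sigma * (t `^ rho - s `^ rho)) *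
  s `^ (rho - 1).

Definition rint (g : R) (h : R -> R) (t : R) : R :=
  rho / Gamma g * Rintegral mu `[0, t]%classic (fun s => rker g t s * h s).

Lemma eq_rint g (h h' : R -> R) t : (forall s, 0 <= s <= t -> h s = h' s) ->
  rint g h t = rint g h' t.
Proof.
move=> hh'; congr (_ * _); apply: eq_Rintegral => s; rewrite inE/= in_itv/= => st.
by rewrite hh'.
Qed.

Lemma ge0_rpow (x p : R) : 0 <= x -> rpow x p = x `^ p.
Proof. by rewrite /rpow => ->. Qed.

Let kerE g t s (z : R[i]) : 0 <= s <= t ->
  cpow (rpow t rho - rpow s rho) (g - 1)
    * (expR (- sigma * (rpow t rho - rpow s rho)))%:C
    * (rpow s (rho - 1))%:C * z = (rker g t s)%:C * z.
Proof.
move=> /andP[s0 st]; have t0 := le_trans s0 st.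
have d0 : 0 <= t `^ rho - s `^ rho.
  by rewrite subr_ge0 ge0_ler_powR ?nnegrE// ltW.
by rewrite !ge0_rpow// /cpow d0 mulr1 (ger0_norm d0) -!rmorphM.
Qed.

(** From the origin on the kernel is real, so that the operator acts separately
    on real and imaginary parts. *)
Lemma Re_subst_integral g (psi : R -> R[i]) t :
  complex.Re (subst_integral sigma rho 0 g psi t) = rint g (fun s => complex.Re (psi s)) t.
Proof.
rewrite /subst_integral ReZ; congr (_ * _); apply: eq_Rintegral => s.
by rewrite inE/= in_itv/= => st; rewrite kerE// ReZ.
Qed.

Lemma Im_subst_integral g (psi : R -> R[i]) t :
  complex.Im (subst_integral sigma rho 0 g psi t) = rint g (fun s => complex.Im (psi s)) t.
Proof.
rewrite /subst_integral ImZ; congr (_ * _); apply: eq_Rintegral => s.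
by rewrite inE/= in_itv/= => st; rewrite kerE// ImZ.
Qed.

Section real_density.
Variable h : R -> R.
(* [lam] is the function assumed integrable, [v] the one that the operators
   integrate. *)
Let lam (s : R) := expR (sigma * s `^ rho) * s `^ (1 - rho) * h s.
Let v (s : R) := expR (sigma * s `^ rho) * s `^ (rho - 1) * h s.
Hypothesis ilam : mu.-integrable `[0, b]%classic (EFin \o lam).

Let vlam s : 0 <= s -> v s = s `^ (2 * (rho - 1)) * lam s.
Proof.
move=> s0; rewrite /v /lam.
have -> : s `^ (rho - 1) = s `^ (2 * (rho - 1)) * s `^ (1 - rho).
  have [->|sn0] := eqVneq s 0; last first.
    by rewrite -powRD; [congr powR; ring|rewrite sn0 implybT].
  have [->|r1] := eqVneq rho 1; first by rewrite subrr mulr0 powRr0 mulr1.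
  by rewrite !powR0 ?mul0r ?mulf_neq0// subr_eq0// eq_sym.
by ring.
Qed.

Let V (s : R) := \1_(`[0, b]%classic) s * v s.

Let ilam1 : mu.-integrable setT (fun s => (\1_(`[0, b]%classic) s * lam s)%:E).
Proof. exact: ((integrable_indic_mul _ (measurable_itv _)).1 ilam). Qed.

Let mV : measurable_fun setT V.
Proof.
rewrite (_ : V = fun s => s `^ (2 * (rho - 1)) * (\1_(`[0, b]%classic) s * lam s)).
  apply: measurable_funM; first exact: measurable_powR.
  by apply/measurable_EFinP; exact: measurable_int ilam1.
apply/funext => s; rewrite /V !indicE !mem_setE !in_itv/=.
have [/andP[s0 _]|_] := boolP (0 <= s <= b); last by rewrite !mul0r mulr0.
by rewrite vlam// !mul1r.
Qed.

(** The singularity of [v] that prevents integrability is at the origin, where the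
    kernel is bounded away from zero: near the origin [v] is dominated by the
    integrand, elsewhere by [lam]. So no integrand is integrable either. *)
Lemma rint_nonintegrable g t : 0 <= t <= b ->
  ~ mu.-integrable setT (EFin \o V) -> rint g h t = 0.
Proof.
move=> /andP[]; rewrite le_eqVlt => /predU1P[<- _ _|t0 tb nV].
  by rewrite /rint set_itv1 Rintegral_set1 mulr0.
rewrite /rint.
pose c s := (t `^ rho - s `^ rho) `^ (g - 1) * expR (- sigma * t `^ rho).
pose f s := \1_(`[0, t]%classic) s * (c s * V s).
have fE s : \1_(`[0, t]%classic) s * (rker g t s * h s) = f s.
  rewrite /f /V !indicE !mem_setE !in_itv/=.
  have [/andP[sp st]|_] := boolP (0 <= s <= t); last by rewrite !mul0r.
  rewrite sp (le_trans st tb) !mul1r /rker /c /v.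
  have -> : - sigma * (t `^ rho - s `^ rho) = - sigma * t `^ rho + sigma * s `^ rho by ring.
  have assoc (x1 x2 x3 x4 x5 : R) : x1 * (x2 * x3) * x4 * x5 = x1 * x2 * (x3 * x4 * x5).
    by ring.
  by rewrite expRD; exact: assoc.
have mc : measurable_fun setT c.
  apply: measurable_funM => //; apply: (measurableT_comp (@measurable_powR R (g - 1))).
  by apply: measurable_funB => //; exact: measurable_powR.
have mf : measurable_fun setT f.
  apply: measurable_funM; first exact: measurable_indic.
  exact: measurable_funM.
rewrite Rintegral_indic.
have -> : Rintegral mu setT (fun s => \1_(`[0, t]%classic) s * (rker g t s * h s)) =
    Rintegral mu setT f by apply: eq_Rintegral => s _; exact: fE.
rewrite Rintegral_nonintegrable ?mulr0// => fi; apply: nV.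
have t20 : 0 < t / 2 by rewrite divr_gt0.
have t2t : t / 2 < t by lra.
(* For [s <= t/2], [t^rho - s^rho] lies between [m] and [t^rho]. *)
pose p := 1 - g; pose m := t `^ rho - (t / 2) `^ rho.
have m0 : 0 < m by rewrite subr_gt0 ltr_powRp ?(ltW t20) ?(ltW t0).
pose C1 := expR (sigma * t `^ rho) * (m `^ p + (t `^ rho) `^ p).
pose C2 := (t / 2) `^ (2 * (rho - 1)) + b `^ (2 * (rho - 1)).
have C10 : 0 <= C1 by rewrite mulr_ge0 ?expR_ge0 ?addr_ge0 ?powR_ge0.
have C20 : 0 <= C2 by rewrite addr_ge0 ?powR_ge0.
pose l s := \1_(`[0, b]%classic) s * lam s.
have ib : mu.-integrable setT (fun s => C1%:E * (`|f s|)%:E + C2%:E * (`|l s|)%:E)%E.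
  apply: integrableD => //; apply: integrableZl => //.
  - exact: integrable_norm fi.
  - exact: integrable_norm ilam1.
apply: (@le_integrable _ _ _ mu setT measurableT _ _ _ _ ib).
  exact/measurable_EFinP.
have K s : `|V s| <= C1 * `|f s| + C2 * `|l s|.
  have [sI|sI] := boolP (0 <= s <= b); last first.
    rewrite /V indicE mem_setE in_itv/= (negbTE sI) mul0r normr0.
    by rewrite addr_ge0// mulr_ge0.
  have [s0 sb] := andP sI.
  have VE : V s = v s by rewrite /V indicE mem_setE in_itv/= sI mul1r.
  have [s2|s2] := leP s (t / 2); last first.
    apply: (@le_trans _ _ (C2 * `|l s|)); last by rewrite lerDr mulr_ge0.
    rewrite VE vlam// /l indicE mem_setE in_itv/= s0 sb mul1r.
    rewrite normrM ler_wpM2r// ger0_norm ?powR_ge0//.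
    by apply: powR_le_bounds => //; rewrite (ltW s2).
  apply: (@le_trans _ _ (C1 * `|f s|)); last by rewrite lerDl mulr_ge0.
  rewrite /f indicE mem_setE in_itv/= s0 (le_trans s2 (ltW t2t)) mul1r.
  set x := t `^ rho - s `^ rho.
  have mx : m <= x.
    by rewrite lerD2l lerN2 ge0_ler_powR ?nnegrE ?s0 ?(ltW rho_gt0) ?(ltW t20).
  have x0 : 0 < x := lt_le_trans m0 mx.
  have xM : x <= t `^ rho by rewrite lerBlDr lerDl powR_ge0.
  have cx : expR (sigma * t `^ rho) * x `^ p * c s = 1.
    have assoc (x1 x2 x3 x4 : R) : x1 * x2 * (x3 * x4) = (x1 * x4) * (x2 * x3) by ring.
    rewrite /c -/x assoc -expRD -powRD; last by rewrite (gt_eqF x0) implybT.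
    have -> : sigma * t `^ rho + - sigma * t `^ rho = 0 by ring.
    by rewrite (_ : p + (g - 1) = 0) ?expR0 ?powRr0 ?mulr1// /p; ring.
  have Vx : V s = expR (sigma * t `^ rho) * x `^ p * (c s * V s) by rewrite mulrA cx mul1r.
  rewrite {1}Vx normrM ler_wpM2r// ger0_norm ?mulr_ge0 ?expR_ge0 ?powR_ge0//.
  by rewrite ler_wpM2l ?expR_ge0// powR_le_bounds// mx.
move=> s _; rewrite /= lee_fin.
by rewrite (le_trans (K s))// ler_norm.
Qed.

Variables alpha beta : R.
Hypotheses (alpha0 : 0 < alpha) (beta0 : 0 < beta).

(** If [v] is not integrable, all the operators give zero; otherwise this is the
    integrable case for the complex function [h]. *)
Lemma rint_semigroup : {ae mu, forall t, 0 <= t <= b ->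
  rint alpha (rint beta h) t = rint (alpha + beta) h t}.
Proof.
have [iV|nV] := pselect (mu.-integrable setT (EFin \o V)); last first.
  apply: (ae_imp _ (ae_neq 0)) => t _ tb.
  rewrite [RHS]rint_nonintegrable//.
  rewrite (@eq_rint _ _ (fun=> 0)); last first.
    move=> s /andP[s0 st]; apply: rint_nonintegrable => //.
    by rewrite s0 (le_trans st)//; case/andP: tb.
  rewrite /rint (_ : Rintegral _ _ _ = 0) ?mulr0//.
  by rewrite /Rintegral integral0_eq// => s _; rewrite mulr0.
have hpow t : 0 <= t <= b -> rpow_defined t rho.
  case/andP; rewrite le_eqVlt => /predU1P[<- _|t0 _]; last by left.
  by right; left.
have ih : cintegrable `[0, b]%classic
    (fun s => (expR (sigma * rpow s rho) * rpow s (rho - 1))%:C * (h s)%:C).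
  have i0 : mu.-integrable `[0, b]%classic (EFin \o v).
    exact: ((integrable_indic_mul v (measurable_itv _)).2 iV).
  have Re_v s : 0 <= s -> v s =
      complex.Re ((expR (sigma * rpow s rho) * rpow s (rho - 1))%:C * (h s)%:C).
    by move=> s0; rewrite ReZ !ge0_rpow.
  have Im_v s : 0 =
      complex.Im ((expR (sigma * rpow s rho) * rpow s (rho - 1))%:C * (h s)%:C).
    by rewrite ImZ mulr0.
  split.
  - apply: (@eq_integrable _ _ _ mu _ (measurable_itv _) (EFin \o v) _ _ i0) => s.
    by rewrite inE/= in_itv/= => /andP[s0 _]; congr EFin; exact: Re_v.
  - apply: (@eq_integrable _ _ _ mu _ (measurable_itv _) (cst 0)).
      by move=> s _; congr EFin; exact: Im_v.
    exact: integrable0.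
have := subst_integral_semigroup_integrable (lt0r_neq0 rho_gt0) alpha0 beta0 hpow ih.
pose hC s := (h s)%:C.
apply: ae_imp => t H tb.
rewrite -[RHS](Re_subst_integral (alpha + beta) hC t) -(H tb).
rewrite (Re_subst_integral alpha (subst_integral sigma rho 0 beta hC) t).
by apply: eq_rint => s _; rewrite (Re_subst_integral beta hC s).
Qed.

End real_density.
Lemma subst_integral_semigroup_origin (alpha beta : R) (psi : R -> R[i]) :
  0 < alpha -> 0 < beta -> Lambda1 sigma rho 0 b psi ->
  {ae mu, forall t, 0 <= t <= b ->
    subst_integral sigma rho 0 alpha (subst_integral sigma rho 0 beta psi) t =
    subst_integral sigma rho 0 (alpha + beta) psi t}.
Proof.
move=> a0 be0 [ir ii].
have part (h : R -> R) (g : R -> R) : (forall s, 0 <= s -> g s =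
      (expR (sigma * rpow s rho) * rpow s (1 - rho)) * h s) ->
    mu.-integrable `[0, b]%classic (EFin \o g) ->
    mu.-integrable `[0, b]%classic
      (EFin \o (fun s => expR (sigma * s `^ rho) * s `^ (1 - rho) * h s)).
  move=> gE; apply: eq_integrable; first exact: measurable_itv.
  by move=> s; rewrite inE/= in_itv/= => /andP[s0 _]; rewrite gE// !ge0_rpow.
have Hr := rint_semigroup (part _ _ (fun s _ => ReZ _ _) ir) a0 be0.
have Hi := rint_semigroup (part _ _ (fun s _ => ImZ _ _) ii) a0 be0.
apply: ae_imp2 Hr Hi => t Hr Hi tb; apply: complex_eqP.
- rewrite (Re_subst_integral (alpha + beta) psi t) -(Hr tb).
  rewrite (Re_subst_integral alpha (subst_integral sigma rho 0 beta psi) t).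
  by apply: eq_rint => s _; exact: (Re_subst_integral beta psi s).
- rewrite (Im_subst_integral (alpha + beta) psi t) -(Hi tb).
  rewrite (Im_subst_integral alpha (subst_integral sigma rho 0 beta psi) t).
  by apply: eq_rint => s _; exact: (Im_subst_integral beta psi s).
Qed.

End origin.

(** Away from the origin, or when [rho >= 1], the weights [t^(rho - 1)] and
    [t^(1 - rho)] differ by a bounded factor. *)
Lemma Lambda1_integrable (R : realType) (a b sigma rho : R) (psi : R -> R[i]) :
  (forall t, a <= t <= b -> rpow_defined t rho) ->
  (a <= 0 <= b -> 1 <= rho) -> Lambda1 sigma rho a b psi ->
  cintegrable `[a, b]
    (fun s => (expR (sigma * rpow s rho) * rpow s (rho - 1))%:C * psi s).
Proof.
move=> hpow rho1 [ir ii].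
have [C HC] : exists C : R, forall x, a <= x <= b -> `|x| `^ (2 * (rho - 1)) <= C.
  by apply: norm_powR_bounded => /rho1 h; rewrite mulr_ge0// subr_ge0.
pose r (s : R) := `|s| `^ (2 * (rho - 1)).
have mr : measurable_fun setT r := measurable_normr_powR _.
have rC (s : R) : `[a, b]%classic s -> `|r s| <= C.
  by rewrite /= in_itv/= ger0_norm ?powR_ge0//; exact: HC.
have rE (s : R) : a <= s <= b -> rpow s (rho - 1) = r s * rpow s (1 - rho).
  move=> sab; rewrite (rpow_subr1E hpow sab) (rpow_1subrE hpow sab) /spow mulrA.
  congr (_ * _); rewrite /r; have [->|s0] := eqVneq s 0.
    rewrite normr0; have [->|n1] := eqVneq rho 1.
      by rewrite subrr mulr0 powRr0 mulr1.
    by rewrite powR0 ?subr_eq0// powR0 ?mul0r// mulf_neq0// subr_eq0.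
  rewrite -powRD; last by rewrite normr_eq0 s0 implybT.
  by congr powR; ring.
have part (P : R[i] -> R) : (forall (x : R) z, P (x%:C * z) = x * P z) ->
    (@lebesgue_measure R).-integrable `[a, b]%classic (fun t =>
      (P ((expR (sigma * rpow t rho) * rpow t (1 - rho))%:C * psi t))%:E) ->
    (@lebesgue_measure R).-integrable `[a, b]%classic (fun t =>
      (P ((expR (sigma * rpow t rho) * rpow t (rho - 1))%:C * psi t))%:E).
  move=> PZ; move/(bounded_mul_integrable (measurable_itv _) mr rC).
  apply: eq_integrable; first exact: measurable_itv.
  move=> s; rewrite inE/= in_itv/= => sab; rewrite !PZ (rE s sab).
  by rewrite !mulrA (mulrC (r s)).
by split; apply: part => //; [exact: ReZ|exact: ImZ].
Qed.

(** * The semigroup law *)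

Theorem theorem3 (R : realType) (a b sigma rho alpha beta : R)
    (psi : R -> R[i])
    (hab : a < b) (hrho : rho != 0) (halpha : 0 < alpha) (hbeta : 0 < beta)
    (hpow : forall t, a <= t <= b -> rpow_defined t rho)
    (hpsi : Lambda1 sigma rho a b psi) :
  {ae (@lebesgue_measure R), forall t, a <= t <= b ->
    subst_integral sigma rho a alpha (subst_integral sigma rho a beta psi) t =
    subst_integral sigma rho a (alpha + beta) psi t}.
Proof.
have [/andP[ab0 rho1]|nbad] := boolP ((a <= 0 <= b) && (rho < 1)); last first.
  apply: subst_integral_semigroup_integrable => //.
  apply: Lambda1_integrable => // ab0.
  by move: nbad; rewrite ab0/= -leNgt.
have rho_gt0 := rho_gt0_at0 hpow ab0.
(* A negative [a] would make [rho] an integer strictly between 0 and 1. *)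
have a0 : a = 0.
  apply/eqP; rewrite eq_le; case/andP: (ab0) => -> _ /=; rewrite leNgt; apply/negP => an.
  have aab : a <= a <= b by rewrite lexx ltW.
  have rho_z := rho_int hpow aab an.
  by move: rho_gt0 rho1; rewrite rho_z ltr0z ltrz1 gtz0_ge1 ltNge => ->.
subst a; exact: subst_integral_semigroup_origin.
Qed.
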